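(* Let $\tau=(\tau_\sigma)_{\sigma\in\Sigma}$ be an equivariant structure on the principal $K$-bundle $P$, let $u=(u_\sigma)_{\sigma\in\Sigma}$ be a modifying family of elements in $\mathcal{G}_P$ and let $c_u$ be the associated $2$-cocycle. Let $$\mathcal{T}:\left(F^{-1}(\{\xi\})_{\mathrm{irr}}/\mathcal{G}_P\right)^\Sigma\longrightarrow H^2(\Sigma;\mathcal{Z}(K))$$ be the type map. Then there is a decomposition $$\mathcal{T}^{-1}(\{[c_u]\})=\bigsqcup_{\overline{[b]}\in H^1_u(\Sigma,\mathcal{G}_P)/H^1(\Sigma,\mathcal{Z}(\mathcal{G}_P))}\mathrm{Im}\,j_{\tau,u^b},$$ where $u^b$ is the modifying family $u^b_\sigma=b(\sigma)u_\sigma$ determined by $u$ and a choice of $1$-cocycle $b\in[b]$. Moreover, the non-empty fibres of $j_{\tau,u}$ are in bijection with the pointed set $$\ker\big(H^1(\Sigma;\mathcal{Z}(K))\longrightarrow H^1_u(\Sigma;\mathcal{G}_P)\big).$$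
   Context: $X$ is a compact connected Riemann surface of genus $g\geq2$ and $\Sigma$ is a subgroup of the (finite) group $\mathrm{Aut}^{\pm}(X)$ of holomorphic and anti-holomorphic bijective transformations of $X$. $G_{\mathbb{C}}$ is a connected reductive complex Lie group, $\theta:G_{\mathbb{C}}\to G_{\mathbb{C}}$ is the anti-holomorphic group involution defining its split real form, $K\subset G_{\mathbb{C}}$ is a $\theta$-invariant maximal compact subgroup with centre $\mathcal{Z}(K)$, and $P$ is a smooth principal $K$-bundle over $X$. $\Sigma$ acts on $K$ and $\mathcal{Z}(K)$ by $\theta_\sigma=\mathrm{Id}$ if $\sigma$ is holomorphic and $\theta_\sigma=\theta$ if $\sigma$ is anti-holomorphic. An equivariant structure on $P$ is a family $\tau=(\tau_\sigma)_{\sigma\in\Sigma}$ of bundle maps $\tau_\sigma:P\to P$ such that (1) $\tau_\sigma$ covers $\sigma:X\to X$; (2) $\tau_\sigma(k\cdot p)=\theta_\sigma(k)\cdot\tau_\sigma(p)$ for all $k\in K$, $p\in P$; (3) $\tau_{1_\Sigma}=\mathrm{Id}_P$ and $\tau_{\sigma_1}\tau_{\sigma_2}=\tau_{\sigma_1\sigma_2}$. $\mathcal{A}_P$ is the space of $K$-connections on $P$ and $\mathcal{G}_P$ is the gauge group of $P$ (automorphisms over $\mathrm{Id}_X$), acting on $\mathcal{A}_P$ by $g\cdot A=(g^{-1})^*A$. Given $\tau$, $\Sigma$ acts on $\mathcal{A}_P$ by letting $\beta^\tau_\sigma(A)$ be the connection obtained by transporting $A$ through $\tau_\sigma$ (its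 horizontal distribution is the image under $\tau_\sigma$ of that of $A$), and on $\mathcal{G}_P$ by $\alpha^\tau_\sigma(g)=\tau_\sigma g\tau_\sigma^{-1}$; one has $\beta^\tau_\sigma(g\cdot A)=\alpha^\tau_\sigma(g)\cdot\beta^\tau_\sigma(A)$. $\mathcal{Z}(\mathcal{G}_P)$ denotes the subgroup of gauge transformations $p\mapsto z\cdot p$ with $z\in\mathcal{Z}(K)$; it is $\Sigma$-equivariantly isomorphic to $\mathcal{Z}(K)$ and acts trivially on $\mathcal{A}_P$. Fix a Riemannian metric on $X$ compatible with the complex structure, for which all elements of $\Sigma$ are isometries, with area form $\omega$. $\xi$ is an element of the centre of the Lie algebra of $K$, and $F^{-1}(\{\xi\})$ is the set of (projectively flat) connections in $\mathcal{A}_P$ whose curvature is $\omega\otimes\xi$; $\xi$ is assumed to be such that $F^{-1}(\{\xi\})\neq\emptyset$. This set is preserved by $\Sigma$ and $\mathcal{G}_P$. $F^{-1}(\{\xi\})_{\mathrm{irr}}$ is the subset of irreducible connections, i.e. those $A$ with $\mathrm{Stab}_{\mathcal{G}_P}(A)=\mathcal{Z}(\mathcal{G}_P)$. $\Sigma$ acts on $F^{-1}(\{\xi\})_{\mathrm{irr}}/\mathcal{G}_P$ via $\beta^\tau$. Type map: if the orbit $[A_0]=\mathcal{G}_P\cdot A_0$ is $\Sigma$-fixed, choose $(u_\sigma)_{\sigma\in\Sigma}$ in $\mathcal{G}_P$ with $u_{1_\Sigma}=1$ and $u_\sigma\cdot\beta^\tau_\sigma(A_0)=A_0$ for all $\sigma$;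 then $c(\sigma_1,\sigma_2)=u_{\sigma_1}\alpha^\tau_{\sigma_1}(u_{\sigma_2})u_{\sigma_1\sigma_2}^{-1}$ is a normalised $2$-cocycle with values in $\mathrm{Stab}_{\mathcal{G}_P}(A_0)=\mathcal{Z}(\mathcal{G}_P)\simeq\mathcal{Z}(K)$, and $\mathcal{T}([A_0]):=[c]\in H^2(\Sigma;\mathcal{Z}(K))$, which depends only on $[A_0]$. Modifying family: a tuple $u=(u_\sigma)_{\sigma\in\Sigma}$ of elements of $\mathcal{G}_P$ with $u_{1_\Sigma}=1$ and such that $c_u(\sigma_1,\sigma_2):=u_{\sigma_1}\alpha^\tau_{\sigma_1}(u_{\sigma_2})u_{\sigma_1\sigma_2}^{-1}\in\mathcal{Z}(\mathcal{G}_P)$ for all $\sigma_1,\sigma_2$; $c_u$ is then a $2$-cocycle. Such a $u$ defines new $\Sigma$-actions $\beta^{\tau,u}_\sigma(A)=u_\sigma\cdot\beta^\tau_\sigma(A)$ on $\mathcal{A}_P$ and $\alpha^{\tau,u}_\sigma(g)=u_\sigma\alpha^\tau_\sigma(g)u_\sigma^{-1}$ on $\mathcal{G}_P$. Fixed-point sets for these actions are denoted by the superscript $(\Sigma,\tau,u)$, and $$j_{\tau,u}:F^{-1}(\{\xi\})_{\mathrm{irr}}^{(\Sigma,\tau,u)}/\mathcal{G}_P^{(\Sigma,\tau,u)}\longrightarrow\left(F^{-1}(\{\xi\})_{\mathrm{irr}}/\mathcal{G}_P\right)^\Sigma$$ is the map induced by inclusion. $H^1_u(\Sigma,\mathcal{G}_P)$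 is the first (non-abelian) cohomology set of $\Sigma$ with coefficients in $\mathcal{G}_P$ for the action $\alpha^{\tau,u}$ (normalised $1$-cocycles). For a $1$-cocycle $b$ for this action, $u^b_\sigma:=b(\sigma)u_\sigma$ is a modifying family with $c_{u^b}=c_u$; $\mathrm{Im}\,j_{\tau,u^b}$ depends only on the class $[b]$. The group $H^1(\Sigma,\mathcal{Z}(\mathcal{G}_P))$ acts on $H^1_u(\Sigma,\mathcal{G}_P)$ by $(ab)(\sigma)=a_\sigma b(\sigma)$, and $\overline{[b]}$ denotes the orbit of $[b]$. The map $H^1(\Sigma;\mathcal{Z}(K))\to H^1_u(\Sigma;\mathcal{G}_P)$ is induced by $\mathcal{Z}(K)\simeq\mathcal{Z}(\mathcal{G}_P)\subset\mathcal{G}_P$, and its kernel is the preimage of the trivial class. *)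

(* Defs.v *)
From HB Require Import structures.
From mathcomp Require Import all_boot all_order all_algebra.
From mathcomp Require Import complex.
From mathcomp Require Import all_classical all_reals all_analysis.
Import Order.TTheory GRing.Theory Num.Theory numFieldNormedType.Exports.

Set Implicit Arguments.
Unset Strict Implicit.
Unset Printing Implicit Defensive.

Local Open Scope classical_set_scope.
Local Open Scope ring_scope.

(* Cohomology of [S] with coefficients in [C], which is meant to be an
   [act]-stable subgroup of [G].  A cohomology class is the set of all cocycles
   cohomologous to a given one, and [H1] is the set of these classes. *)

Section Cohomology.
Variables (S G : groupType) (C : set G) (act : S -> G -> G).
Local Open Scope group_scope.

Definition cocycle1 : set (S -> G) :=
  [set b | [/\ forall s, C (b s), b 1 = 1 &
               forall s t, b (s * t) = b s * act s (b t)]].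

Definition class1 (b : S -> G) : set (S -> G) :=
  [set b' | cocycle1 b' /\
     exists2 g, C g & forall s, b' s = g * b s * (act s g)^-1].

Definition H1 : set (set (S -> G)) := class1 @` cocycle1.

(* These are used with [C] abelian only. *)
Definition cocycle2 : set (S -> S -> G) :=
  [set c | [/\ forall s t, C (c s t), forall s, c 1 s = 1 /\ c s 1 = 1 &
     forall r s t, c r s * c (r * s) t = act r (c s t) * c r (s * t)]].

Definition class2 (c : S -> S -> G) : set (S -> S -> G) :=
  [set c' | cocycle2 c' /\
     exists z : S -> G, [/\ forall s, C (z s), z 1 = 1 &
       forall s t, c' s t = z s * act s (z t) * (z (s * t))^-1 * c s t]].

End Cohomology.

Fixpoint Ck (R : realType) (n : nat) (k : nat) (U : set 'rV[R]_n)
    (f : 'rV[R]_n -> R) : Prop :=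
  {within U, continuous f} /\
  if k is k'.+1 then
    forall a : 'rV[R]_n, (forall x, U x -> derivable f x a) /\
                         Ck k' U (fun x => 'D_a f x)
  else True.

Definition Cinf (R : realType) (n : nat) (U : set 'rV[R]_n)
  (f : 'rV[R]_n -> R) : Prop := forall k, Ck k U f.

(* [cinv] is meaningful on the image of [cdom] only. *)
Record chart (R : realType) (n : nat) (M : Type) := Chart {
  cdom : set M;
  cmap : M -> 'rV[R]_n;
  cinv : 'rV[R]_n -> M }.

HB.mixin Record isCharted (R : realType) (n : nat) M of Topological M := {
  atlas : set (chart R n M) }.

#[short(type="chartedType")]
HB.structure Definition Charted (R : realType) (n : nat) :=
  { M of isCharted R n M & Topological M }.

Definition prod_chart (R : realType) (m n : nat) (M N : Type)
    (c : chart R m M) (d : chart R n N) : chart R (m + n) (M * N)%type :=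
  Chart (cdom c `*` cdom d) (fun p => row_mx (cmap c p.1) (cmap d p.2))
    (fun x => (cinv c (lsubmx x), cinv d (rsubmx x))).

HB.instance Definition _ (R : realType) (m n : nat)
    (M : chartedType R m) (N : chartedType R n) :=
  isCharted.Build R (m + n) (M * N)%type
    [set prod_chart c d | c in atlas & d in atlas].

HB.instance Definition _ (R : realType) (n : nat) :=
  isCharted.Build R n 'rV[R]_n [set Chart setT id id].

(* In what follows, [U] is always an open set. *)
Definition smooth_on (R : realType) (n : nat) (M : chartedType R n)
    (U : set M) (f : M -> R) : Prop :=
  forall c, atlas c -> Cinf (cmap c @` (U `&` cdom c)) (f \o cinv c).

Definition smooth (R : realType) (n : nat) (M : chartedType R n)
  (f : M -> R) : Prop := smooth_on setT f.

(* A map is smooth if it is continuous and pulls back local smooth functions to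
   smooth functions. *)
Definition smooth_map_on (R : realType) (m n : nat) (M : chartedType R m)
    (N : chartedType R n) (U : set M) (phi : M -> N) : Prop :=
  (forall p, U p -> {for p, continuous phi}) /\
  forall (V : set N) (f : N -> R), open V -> smooth_on V f ->
    smooth_on (U `&` phi @^-1` V) (f \o phi).

Definition smooth_map (R : realType) (m n : nat) (M : chartedType R m)
  (N : chartedType R n) (phi : M -> N) : Prop := smooth_map_on setT phi.

Definition is_chart (R : realType) (n : nat) (M : topologicalType)
    (c : chart R n M) : Prop :=
  [/\ open (cdom c), open (cmap c @` cdom c),
      forall p, cdom c p -> cinv c (cmap c p) = p,
      {within cdom c, continuous (cmap c)} &
      {within cmap c @` cdom c, continuous (cinv c)}].

Definition smoothly_compatible (R : realType) (n : nat) (M : Type)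
    (c d : chart R n M) : Prop :=
  forall j, Cinf (cmap c @` (cdom c `&` cdom d))
                 (fun x => cmap d (cinv c x) 0 j).

HB.mixin Record isManifold (R : realType) (n : nat) M of Charted R n M := {
  mfd_hausdorff : hausdorff_space M;
  mfd_second_countable : @second_countable M;
  mfd_chart : forall c : chart R n M, atlas c -> is_chart c;
  mfd_cover : forall p : M, exists2 c : chart R n M, atlas c & cdom c p;
  mfd_compatible : forall c d : chart R n M,
    atlas c -> atlas d -> smoothly_compatible c d }.

#[short(type="manifoldType")]
HB.structure Definition Manifold (R : realType) (n : nat) :=
  { M of isManifold R n M & Charted R n M }.

(* A tangent vector at [p] is a derivation at [p] of the algebra of smooth
   functions, extended by [0] to the functions that are not smooth; two tangent
   vectors are therefore equal as soon as they agree on smooth functions.  Forms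
   and metrics are functions of arbitrary arguments of type [tvec M], but only
   their values on tangent vectors are meaningful. *)
Definition tvec (R : realType) (n : nat) (M : chartedType R n) : Type :=
  (M -> R) -> R.

Definition tangent (R : realType) (n : nat) (M : chartedType R n) (p : M) :
    set (tvec M) :=
  [set v | [/\ forall (a : R) f g, smooth f -> smooth g ->
                 v (fun x => a * f x + g x) = a * v f + v g,
               forall f g, smooth f -> smooth g ->
                 v (fun x => f x * g x) = f p * v g + g p * v f &
               forall f, ~ smooth f -> v f = 0]].

(* The differential of [phi]; the base point is determined by [v]. *)
Definition pushv (R : realType) (m n : nat) (M : chartedType R m)
    (N : chartedType R n) (phi : M -> N) (v : tvec M) : tvec N :=
  fun h => if `[< smooth h >] then v (h \o phi) else 0.

(* The velocity at [x], in the direction [a], of a map [phi] that need only be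
   defined near [x]. *)
Definition dmap (R : realType) (n m : nat) (M : chartedType R m)
    (phi : 'rV[R]_n -> M) (x a : 'rV[R]_n) : tvec M :=
  fun h => if `[< smooth h >] then 'D_a (h \o phi : 'rV[R]_n -> R) x else 0.

Definition vat (R : realType) (n : nat) (M : chartedType R n)
  (V : (M -> R) -> M -> R) (p : M) : tvec M := fun f => V f p.

Definition vfield (R : realType) (n : nat) (M : chartedType R n) :
    set ((M -> R) -> M -> R) :=
  [set V | (forall p, tangent p (vat V p)) /\
           (forall f, smooth f -> smooth (V f))].

Definition lie_bracket (R : realType) (n : nat) (M : chartedType R n)
    (V W : (M -> R) -> M -> R) : (M -> R) -> M -> R :=
  fun f => V (W f) \- W (V f).

Definition one_form (R : realType) (n : nat) (M : chartedType R n) :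
    set (M -> tvec M -> R) :=
  [set eta | (forall p (a : R) v w, tangent p v -> tangent p w ->
                eta p ((a \*o v) \+ w) = a * eta p v + eta p w) /\
             (forall V, vfield V -> smooth (fun p => eta p (vat V p)))].

Definition closed_form (R : realType) (n : nat) (M : chartedType R n)
    (eta : M -> tvec M -> R) : Prop :=
  forall V W, vfield V -> vfield W -> forall p,
    vat V p (fun q => eta q (vat W q)) - vat W p (fun q => eta q (vat V q))
      - eta p (vat (lie_bracket V W) p) = 0.

(* [b] is the dimension of the first de Rham cohomology group of [M]. *)
Definition first_betti_number (R : realType) (n : nat) (M : chartedType R n)
    (b : nat) : Prop :=
  exists alpha : 'I_b -> M -> tvec M -> R,
    (forall i, one_form (alpha i) /\ closed_form (alpha i)) /\
    forall eta, one_form eta -> closed_form eta ->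
      exists! c : 'rV[R]_b, exists2 f, smooth f &
        forall p v, tangent p v ->
          eta p v = \sum_(i < b) c 0 i * alpha i p v + v f.

(* A complex manifold of dimension [d] has charts in [R^d x R^d], the point
   [(x, y)] standing for [x + i y].  The charts are holomorphic for the complex
   structure on tangent vectors. *)
Definition mulI (R : realType) (d : nat) (a : 'rV[R]_(d + d)) : 'rV[R]_(d + d) :=
  row_mx (- rsubmx a) (lsubmx a).

HB.mixin Record isComplexManifold (R : realType) (d : nat) M
    of Manifold R (d + d) M := {
  cstruct : M -> tvec M -> tvec M;
  cstruct_chart : forall c : chart R (d + d) M, atlas c ->
    forall x, (cmap c @` cdom c) x -> forall a : 'rV[R]_(d + d),
      cstruct (cinv c x) (dmap (cinv c) x a) = dmap (cinv c) x (mulI a) }.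

#[short(type="complexManifoldType")]
HB.structure Definition ComplexManifold (R : realType) (d : nat) :=
  { M of isComplexManifold R d M & Manifold R (d + d) M }.

Definition holomorphic (R : realType) (d e : nat) (M : complexManifoldType R d)
    (N : complexManifoldType R e) (phi : M -> N) : Prop :=
  smooth_map phi /\ forall p v, tangent p v ->
    pushv phi (cstruct p v) = cstruct (phi p) (pushv phi v).

Definition antiholomorphic (R : realType) (d e : nat)
    (M : complexManifoldType R d) (N : complexManifoldType R e)
    (phi : M -> N) : Prop :=
  smooth_map phi /\ forall p v, tangent p v ->
    pushv phi (cstruct p v) = (fun h => - cstruct (phi p) (pushv phi v) h).

(* The Cauchy-Riemann equations. *)
Definition holomorphic_fun (R : realType) (d : nat)
    (M : complexManifoldType R d) (f : M -> R[i]) : Prop :=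
  let u := fun p => complex.Re (f p) in let w := fun p => complex.Im (f p) in
  [/\ smooth u, smooth w & forall p v, tangent p v ->
      cstruct p v u = - v w /\ cstruct p v w = v u].

Definition genus (R : realType) (X : complexManifoldType R 1) (g : nat) : Prop :=
  first_betti_number X g.*2.

HB.mixin Record isLieGroup (R : realType) (n : nat) G
    of Manifold R n G & Group G := {
  lie_mul_smooth : smooth_map (fun xy : G * G => (xy.1 * xy.2)%g);
  lie_inv_smooth : smooth_map (fun x : G => (x^-1)%g) }.

#[short(type="lieGroupType")]
HB.structure Definition LieGroup (R : realType) (n : nat) :=
  { G of isLieGroup R n G & Manifold R n G & Group G }.

(* The differential of the multiplication at [(x, y)] is the sum of those of the
   right translation by [y] and the left translation by [x], so that the
   multiplication is holomorphic when all translations are. *)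
HB.mixin Record isComplexLieGroup (R : realType) (d : nat) G
    of ComplexManifold R d G & LieGroup R (d + d) G := {
  clie_left : forall x : G, holomorphic (fun y : G => (x * y)%g);
  clie_right : forall x : G, holomorphic (fun y : G => (y * x)%g);
  clie_inv : holomorphic (fun x : G => (x^-1)%g) }.

#[short(type="complexLieGroupType")]
HB.structure Definition ComplexLieGroup (R : realType) (d : nat) :=
  { G of isComplexLieGroup R d G & ComplexManifold R d G
       & LieGroup R (d + d) G }.

Definition group_hom (G H : groupType) (phi : G -> H) : Prop :=
  forall x y, phi (x * y)%g = (phi x * phi y)%g.

Definition group_center (G : groupType) : set G :=
  [set z | forall x, (z * x = x * z)%g].

Definition subgroup (G : groupType) (H : set G) : Prop :=
  [/\ H 1%g, forall x y, H x -> H y -> H (x * y)%g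
    & forall x, H x -> H (x^-1)%g].

Definition lie_algebra (R : realType) (n : nat) (K : lieGroupType R n) :
  set (tvec K) := tangent (1%g : K).

Definition left_invariant (R : realType) (n : nat) (K : lieGroupType R n)
    (xi : tvec K) : (K -> R) -> K -> R :=
  fun f x => pushv (fun y : K => (x * y)%g) xi f.

Definition lie_algebra_center (R : realType) (n : nat) (K : lieGroupType R n) :
    set (tvec K) :=
  [set xi | lie_algebra xi /\ forall eta, lie_algebra eta ->
     vat (lie_bracket (left_invariant xi) (left_invariant eta)) 1%g
       = (fun=> 0)].

Definition representation (R : realType) (d : nat) (G : complexLieGroupType R d)
    (n : nat) (rho : G -> 'M[R[i]]_n) : Prop :=
  [/\ rho 1%g = 1%:M, forall x y, rho (x * y)%g = rho x *m rho y
    & forall i j, holomorphic_fun (fun x => rho x i j)].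

Definition semisimple_rep (R : realType) (G : Type) (n : nat)
    (rho : G -> 'M[R[i]]_n) : Prop :=
  forall U : 'M[R[i]]_n, (forall x, stablemx U (rho x)) ->
  exists W : 'M[R[i]]_n, [/\ forall x, stablemx W (rho x),
    (U :&: W)%MS = 0 & row_full (U + W)%MS].

(* A connected complex Lie group is reductive if it has a faithful
   representation and all its finite-dimensional holomorphic representations are
   semisimple (Hochschild-Mostow). *)
Definition reductive (R : realType) (d : nat) (G : complexLieGroupType R d) :
    Prop :=
  (exists n (rho : G -> 'M[R[i]]_n), representation rho /\ injective rho) /\
  (forall n (rho : G -> 'M[R[i]]_n), representation rho -> semisimple_rep rho).

Definition cvec (R : realType) (r : nat) (x : 'rV[R]_(r + r)) : 'rV[R[i]]_r :=
  \row_j Complex (lsubmx x 0 j) (rsubmx x 0 j).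

Definition torus (R : realType) (r : nat) : set 'rV[R[i]]_r :=
  [set z | forall j, z 0 j != 0].

(* [phi] restricts to an injective holomorphic homomorphism from the complex
   torus [(C \ 0)^r] to [G]. *)
Definition torus_embedding (R : realType) (d : nat)
    (G : complexLieGroupType R d) (r : nat) (phi : 'rV[R[i]]_r -> G) : Prop :=
  let U := @cvec R r @^-1` @torus R r in
  let psi := phi \o @cvec R r in
  [/\ smooth_map_on U psi,
      forall x a, U x ->
        cstruct (psi x) (dmap psi x a) = dmap psi x (mulI a),
      forall z w, torus z -> torus w ->
        phi (\row_j (z 0 j * w 0 j)) = (phi z * phi w)%g
    & forall z w, torus z -> torus w -> phi z = phi w -> z = w].

Definition maximal_torus (R : realType) (d : nat) (G : complexLieGroupType R d)
    (r : nat) (phi : 'rV[R[i]]_r -> G) : Prop :=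
  torus_embedding phi /\
  forall r' (phi' : 'rV[R[i]]_r' -> G), torus_embedding phi' ->
    phi @` torus (r:=r) `<=` phi' @` torus (r:=r') ->
    phi' @` torus (r:=r') `<=` phi @` torus (r:=r).

(* The real form defined by [theta] is split if it contains a split maximal
   torus: a maximal torus [(C \ 0)^r] on which [theta] is the complex conjugation
   of the coordinates. *)
Definition split_involution (R : realType) (d : nat)
    (G : complexLieGroupType R d) (theta : G -> G) : Prop :=
  [/\ antiholomorphic theta, group_hom theta, involutive theta &
      exists r (phi : 'rV[R[i]]_r -> G), maximal_torus phi /\
        forall z, torus z -> theta (phi z) = phi (map_mx (@conjc R) z)].

(* [iota] identifies the compact Lie group [K] with a maximal compact subgroup
   of [G]. *)
Definition maximal_compact (R : realType) (k n : nat) (K : lieGroupType R k)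
    (G : lieGroupType R n) (iota : K -> G) : Prop :=
  [/\ compact [set: K], smooth_map iota, group_hom iota, injective iota &
      forall H : set G, subgroup H -> compact H -> range iota `<=` H ->
        H = range iota].

Record principalBundle (R : realType) (k n : nat) (K : lieGroupType R k)
    (X : manifoldType R n) (m : nat) := PrincipalBundle {
  total :> manifoldType R m;
  pact : K -> total -> total;
  pproj : total -> X;
  pact1 : forall p, pact 1%g p = p;
  pactM : forall h l p, pact (h * l)%g p = pact h (pact l p);
  pact_smooth : smooth_map (fun hp : K * total => pact hp.1 hp.2);
  pproj_smooth : smooth_map pproj;
  pproj_act : forall h p, pproj (pact h p) = pproj p;
  (* [p |-> (pproj p, kappa p)] is a local trivialisation, of inverse [psi] *)
  ptriv : forall x : X, exists (U : set X) (kappa : total -> K)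
      (psi : X * K -> total),
    [/\ open U, U x, smooth_map_on (pproj @^-1` U) kappa
      & smooth_map_on (U `*` [set: K]) psi] /\
    [/\ forall h p, U (pproj p) -> kappa (pact h p) = (h * kappa p)%g,
        forall p, U (pproj p) -> psi (pproj p, kappa p) = p
      & forall y h, U y ->
          pproj (psi (y, h)) = y /\ kappa (psi (y, h)) = h] }.

Lemma pact_free (R : realType) (k n : nat) (K : lieGroupType R k)
    (X : manifoldType R n) (m : nat) (P : principalBundle K X m) h l (p : P) :
  pact h p = pact l p -> h = l.
Proof.
have [U [kappa [psi [[_ Up _ _] [kappaE _ _]]]]] := ptriv P (pproj p).
by move=> /(congr1 kappa); rewrite !kappaE // => /mulIg.
Qed.

Lemma smooth_map_comp (R : realType) (l m n : nat) (L : chartedType R l)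
    (M : chartedType R m) (N : chartedType R n) (phi : M -> N) (psi : L -> M) :
  smooth_map phi -> smooth_map psi -> smooth_map (phi \o psi).
Proof.
move=> [phic phis] [psic psis]; split.
  by move=> p _; apply: continuous_comp; [exact: psic|exact: phic].
move=> V f Vo Vf; have := phis V f Vo Vf; rewrite !setTI => sV.
have -> : (phi \o psi) @^-1` V = psi @^-1` (phi @^-1` V) by [].
rewrite -[X in smooth_on X]setTI; apply: psis sV.
by apply: open_comp => // x _; exact: phic.
Qed.

Lemma smooth_map_id (R : realType) (n : nat) (M : chartedType R n) :
  smooth_map (@id M).
Proof.
split=> [p _|V f _ Vf]; first exact: cvg_id.
by rewrite setTI.
Qed.

(* Automorphisms of [P] over the identity of [X]. *)
Record gauge (R : realType) (k n : nat) (K : lieGroupType R k)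
    (X : manifoldType R n) (m : nat) (P : principalBundle K X m) := Gauge {
  gfun :> P -> P;
  ginv : P -> P;
  gfun_smooth : smooth_map gfun;
  ginv_smooth : smooth_map ginv;
  gfunK : cancel gfun ginv;
  ginvK : cancel ginv gfun;
  gfun_act : forall h p, gfun (pact h p) = pact h (gfun p);
  gfun_proj : forall p, pproj (gfun p) = pproj p }.

Section GaugeGroup.
Variables (R : realType) (k n : nat) (K : lieGroupType R k).
Variables (X : manifoldType R n) (m : nat) (P : principalBundle K X m).
Implicit Types g h : gauge P.

HB.instance Definition _ := gen_eqMixin (gauge P).
HB.instance Definition _ := gen_choiceMixin (gauge P).

Lemma gauge_eq g h : gfun g =1 gfun h -> g = h.
Proof.
case: g h => [f f' s s' K1 K2 e o] [r r' t t' L1 L2 e' o'] /= /funext fr.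
move: s K1 K2 e o; rewrite fr => s K1 K2 e o.
have f'r' : f' = r' by apply/funext => p; rewrite -{1}(L2 p) K1.
by move: s' K1 K2; rewrite f'r' => s' K1 K2; congr Gauge; exact: Prop_irrelevance.
Qed.

Definition gauge_one : gauge P :=
  @Gauge _ _ _ K X m P id id (@smooth_map_id _ _ _) (@smooth_map_id _ _ _)
    (fun=> erefl) (fun=> erefl) (fun _ _ => erefl) (fun=> erefl).

Lemma ginv_act g l p : ginv g (pact l p) = pact l (ginv g p).
Proof. by rewrite -{1}(ginvK g p) -gfun_act gfunK. Qed.

Lemma ginv_proj g p : pproj (ginv g p) = pproj p.
Proof. by rewrite -{2}(ginvK g p) gfun_proj. Qed.

Definition gauge_inv g : gauge P :=
  Gauge (ginv_smooth g) (gfun_smooth g) (@ginvK _ _ _ _ _ _ _ g)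
    (@gfunK _ _ _ _ _ _ _ g) (ginv_act g) (ginv_proj g).

Lemma gauge_mul_act g h l p : (g \o h) (pact l p) = pact l ((g \o h) p).
Proof. by rewrite /= !gfun_act. Qed.

Lemma gauge_mul_proj g h p : pproj ((g \o h) p) = pproj p.
Proof. by rewrite /= !gfun_proj. Qed.

Definition gauge_mul g h : gauge P :=
  Gauge (smooth_map_comp (gfun_smooth g) (gfun_smooth h))
    (smooth_map_comp (ginv_smooth h) (ginv_smooth g))
    (can_comp (@gfunK _ _ _ _ _ _ _ g) (@gfunK _ _ _ _ _ _ _ h))
    (can_comp (@ginvK _ _ _ _ _ _ _ h) (@ginvK _ _ _ _ _ _ _ g))
    (gauge_mul_act g h) (gauge_mul_proj g h).

Lemma gauge_mulA : associative gauge_mul.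
Proof. by move=> f g h; exact: gauge_eq. Qed.
Lemma gauge_mul1g : left_id gauge_one gauge_mul.
Proof. by move=> g; exact: gauge_eq. Qed.
Lemma gauge_mulg1 : right_id gauge_one gauge_mul.
Proof. by move=> g; exact: gauge_eq. Qed.
Lemma gauge_mulVg : left_inverse gauge_one gauge_inv gauge_mul.
Proof. by move=> g; apply: gauge_eq => p /=; rewrite gfunK. Qed.
Lemma gauge_mulgV : right_inverse gauge_one gauge_inv gauge_mul.
Proof. by move=> g; apply: gauge_eq => p /=; rewrite ginvK. Qed.

HB.instance Definition _ := isGroup.Build (gauge P)
  gauge_mulA gauge_mul1g gauge_mulg1 gauge_mulVg gauge_mulgV.

End GaugeGroup.

Lemma row_mx_continuous (R : realType) (m n : nat) (w : 'rV[R]_m) :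
  continuous (fun x : 'rV[R]_n => row_mx w x).
Proof.
move=> x A [Q Qx QA].
exists (fun i j => Q i (rshift m j)).
  by move=> i j; have := Qx i (rshift m j); rewrite row_mxEr.
move=> y Qy; apply: QA => i j /=; case: (split_ordP j) => l ->.
  by rewrite row_mxEl; have := Qx i (lshift n l); rewrite row_mxEl => /nbhs_singleton.
by rewrite row_mxEr; exact: Qy.
Qed.

Lemma Ck_row_mx (R : realType) (m n j : nat) (w : 'rV[R]_m)
    (W : set 'rV[R]_(m + n)) (U : set 'rV[R]_n) (f : 'rV[R]_(m + n) -> R) :
  (forall x, U x -> W (row_mx w x)) -> Ck j W f ->
  Ck j U (fun x => f (row_mx w x)).
Proof.
move=> UW; have cont (h : 'rV[R]_(m + n) -> R) : {within W, continuous h} ->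
    {within U, continuous (fun x => h (row_mx w x))}.
  move=> /subspace_continuousP ch; apply/subspace_continuousP => x Ux.
  apply: (cvg_comp (fun x => row_mx w x) h _ (ch _ (UW _ Ux))).
  move=> A /=; rewrite /within /= => nA.
  have := @row_mx_continuous R m n w x _ nA.
  by rewrite /= !nbhs_simpl /=; apply: filterS => y /= Ay /UW; exact: Ay.
elim: j f => [|j IH] f /= [fc fd]; first by split => //; exact: cont.
split; first exact: cont.
have slope (a x : 'rV[R]_n) h : row_mx w (h *: a + x) =
    h *: row_mx (0 : 'rV[R]_m) a + row_mx w x.
  by rewrite scale_row_mx scaler0 add_row_mx add0r.
move=> a; have [da ka] := fd (row_mx 0 a); split.
  move=> x Ux.
  suff -> : derivable (fun y => f (row_mx w y)) x a =
      derivable f (row_mx w x) (row_mx 0 a) by exact/da/UW.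
  by rewrite /derivable; under eq_fun do rewrite /= slope.
have -> : (fun x => 'D_a (fun x0 => f (row_mx w x0)) x) =
    (fun x => 'D_(row_mx 0 a) f (row_mx w x)).
  by apply/funext => x; rewrite /derive; under eq_fun do rewrite /= slope.
exact: (IH _ ka).
Qed.

Lemma pact_smoothl (R : realType) (k n : nat) (K : lieGroupType R k)
    (X : manifoldType R n) (m : nat) (P : principalBundle K X m) (z : K) :
  smooth_map (pact z : P -> P).
Proof.
have [actc acts] := pact_smooth P; split.
  move=> p _; have /= := actc (z, p) I.
  move=> cz; apply: (@continuous_comp _ _ _ (fun p : P => (z, p))
     (fun hp : K * P => pact hp.1 hp.2)) => //.
  by apply: cvg_pair => //=; exact: cvg_cst.
move=> V f Vo Vf c ac j.
have [d ad dz] := mfd_cover z.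
have [_ _ dK _ _] := mfd_chart d ad.
have := acts V f Vo Vf (prod_chart d c); rewrite setTI.
have apc : atlas (prod_chart d c : chart R (k + m) (K * P)%type).
  by exists d => //; exists c.
move=> /(_ apc j) H.
have -> : (f \o pact z) \o cinv c = (fun x => ((f \o
    (fun hp : K * P => pact hp.1 hp.2)) \o cinv (prod_chart d c))
    (row_mx (cmap d z) x)).
  by apply/funext => x /=; rewrite row_mxKl row_mxKr (dK _ dz).
apply: (Ck_row_mx _ H) => _ /= [p [[_ Vp] cp] <-].
by exists (z, p).
Qed.

Section CentralGauge.
Variables (R : realType) (k n : nat) (K : lieGroupType R k).
Variables (X : manifoldType R n) (m : nat) (P : principalBundle K X m).

Section MulCentral.
Variables (z : K) (zK : group_center z).

Lemma pact_center h (p : P) : pact z (pact h p) = pact h (pact z p).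
Proof. by rewrite -!pactM zK. Qed.

Lemma pactK : cancel (pact z : P -> P) (pact z^-1%g).
Proof. by move=> p; rewrite -pactM mulVg pact1. Qed.

Lemma pactVK : cancel (pact z^-1%g) (pact z : P -> P).
Proof. by move=> p; rewrite -pactM mulgV pact1. Qed.

Definition mul_central : gauge P :=
  Gauge (pact_smoothl P z) (pact_smoothl P z^-1%g) pactK pactVK
    pact_center (pproj_act z).

End MulCentral.

(* The gauge transformation [p |-> z p], for [z] in the centre of [K]. *)
Definition gauge_of_center (z : K) : gauge P :=
  if pselect (group_center z) is left zK then mul_central zK else 1%g.

Definition central_gauge : set (gauge P) := gauge_of_center @` @group_center K.

End CentralGauge.
Arguments gauge_of_center {R k n K X m} P z.
Arguments central_gauge {R k n K X m} P.

Section Connections.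
Variables (R : realType) (k n : nat) (K : lieGroupType R k).
Variables (X : manifoldType R n) (m : nat) (P : principalBundle K X m).

Definition distribution : Type := P -> set (tvec P).

Definition vertical (p : P) : set (tvec P) :=
  [set v | tangent p v /\ pushv (@pproj _ _ _ _ _ _ P) v = (fun=> 0)].

(* The last condition says that the horizontal part of a smooth vector field is
   smooth. *)
Definition connection : set distribution :=
  [set H | [/\ forall p, H p `<=` tangent p,
    forall p, H p (fun=> 0) /\
      forall (a : R) v w, H p v -> H p w -> H p ((a \*o v) \+ w),
    forall p v, tangent p v ->
      exists! h, H p h /\ vertical p (v \- h),
    forall h p, H (pact h p) = pushv (pact h : P -> P) @` H p
    & forall V, vfield V -> exists2 W, vfield W &
      forall p, H p (vat W p) /\ vertical p (vat V p \- vat W p)]].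

Definition fundamental (zeta : tvec K) (p : P) : tvec P :=
  pushv (fun h : K => pact h p) zeta.

(* The value at [v] of the connection form of [H] is [zeta]. *)
Definition connection_form (H : distribution) (p : P) (v : tvec P)
    (zeta : tvec K) : Prop :=
  lie_algebra zeta /\ H p (v \- fundamental zeta p).

Definition horizontal_vfield (H : distribution) :
    set ((P -> R) -> P -> R) :=
  [set V | vfield V /\ forall p, H p (vat V p)].

(* The curvature form is the horizontal form that sends horizontal vector fields
   [V] and [W] to minus the value of the connection form at [[V, W]]; here it is
   required to be the pull-back of the form [om] on [X], times [xi]. *)
Definition has_curvature (om : X -> tvec X -> tvec X -> R) (xi : tvec K)
    (H : distribution) : Prop :=
  forall V W, horizontal_vfield H V -> horizontal_vfield H W -> forall p,
    connection_form H p (vat (lie_bracket V W) p)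
      ((- om (pproj p) (pushv (@pproj _ _ _ _ _ _ P) (vat V p))
                       (pushv (@pproj _ _ _ _ _ _ P) (vat W p))) \*o xi).

(* The image of a distribution by the differential of a diffeomorphism. *)
Definition push_distribution (phi : P -> P) (H : distribution) : distribution :=
  fun q => [set w | exists p v, [/\ phi p = q, H p v & w = pushv phi v]].

(* [g . A = (g^-1)^* A] *)
Definition gauge_act (g : gauge P) (H : distribution) : distribution :=
  push_distribution g H.

Definition gauge_orbit (H : distribution) : set distribution :=
  [set gauge_act g H | g in [set: gauge P]].

Definition curvature_fibre (om : X -> tvec X -> tvec X -> R) (xi : tvec K) :
    set distribution :=
  [set H | connection H /\ has_curvature om xi H].

Definition irreducible (H : distribution) : Prop :=
  [set g | gauge_act g H = H] = central_gauge P.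

Definition irreducible_fibre (om : X -> tvec X -> tvec X -> R) (xi : tvec K) :
    set distribution :=
  [set H | curvature_fibre om xi H /\ irreducible H].

End Connections.
Arguments curvature_fibre {R k n K X m} P om xi.
Arguments irreducible_fibre {R k n K X m} P om xi.

Section Surfaces.
Variables (R : realType) (X : complexManifoldType R 1).
Implicit Type g : X -> tvec X -> tvec X -> R.

Definition riemannian_metric g : Prop :=
  [/\ forall p (a : R) u v w, tangent p u -> tangent p v -> tangent p w ->
        g p ((a \*o u) \+ v) w = a * g p u w + g p v w,
      forall p v w, tangent p v -> tangent p w -> g p v w = g p w v,
      forall p v, tangent p v -> v <> (fun=> 0) -> 0 < g p v v
    & forall V W, vfield V -> vfield W ->
        smooth (fun p => g p (vat V p) (vat W p))].

Definition compatible_metric g : Prop :=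
  forall p v w, tangent p v -> tangent p w ->
    g p (cstruct p v) (cstruct p w) = g p v w.

Definition metric_isometry g (phi : X -> X) : Prop :=
  forall p v w, tangent p v -> tangent p w ->
    g (phi p) (pushv phi v) (pushv phi w) = g p v w.

Definition area_form g : X -> tvec X -> tvec X -> R :=
  fun p v w => g p (cstruct p v) w.

Definition aut_subgroup (S : groupType) (rho : S -> X -> X) : Prop :=
  [/\ rho 1%g = id, forall s t, rho (s * t)%g = rho s \o rho t, injective rho
    & forall s, holomorphic (rho s) \/ antiholomorphic (rho s)].

Definition theta_action (S : Type) (rho : S -> X -> X) (T : Type)
    (theta : T -> T) (s : S) : T -> T :=
  if `[< holomorphic (rho s) >] then id else theta.

End Surfaces.

Record equivariantStructure (R : realType) (k n : nat) (K : lieGroupType R k)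
    (X : manifoldType R n) (m : nat) (P : principalBundle K X m)
    (S : groupType) (rho : S -> X -> X) (th : S -> K -> K) :=
  EquivariantStructure {
    tau :> S -> P -> P;
    tau_smooth : forall s, smooth_map (tau s);
    tau_cover : forall s p, pproj (tau s p) = rho s (pproj p);
    tau_act : forall s h p, tau s (pact h p) = pact (th s h) (tau s p);
    tau1 : forall p, tau 1%g p = p;
    tauM : forall s t p, tau s (tau t p) = tau (s * t)%g p }.

Section Equivariant.
Variables (R : realType) (k n : nat) (K : lieGroupType R k).
Variables (X : manifoldType R n) (m : nat) (P : principalBundle K X m).
Variables (S : groupType) (rho : S -> X -> X) (th : S -> K -> K).
Variable tau : equivariantStructure P rho th.

Lemma tauK s : cancel (tau s) (tau s^-1%g).
Proof. by move=> p; rewrite tauM mulVg tau1. Qed.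

Lemma tauVK s : cancel (tau s^-1%g) (tau s).
Proof. by move=> p; rewrite tauM mulgV tau1. Qed.

Section Alpha.
Variables (s : S) (g : gauge P).

Lemma tau_conj_smooth (f : P -> P) : smooth_map f ->
  smooth_map (tau s \o (f \o tau s^-1%g)).
Proof.
move=> fs; apply: smooth_map_comp (smooth_map_comp _ _) => //;
exact: tau_smooth.
Qed.

Lemma tau_conjK (f f' : P -> P) : cancel f f' ->
  cancel (tau s \o (f \o tau s^-1%g)) (tau s \o (f' \o tau s^-1%g)).
Proof. by move=> fK p /=; rewrite tauK fK tauVK. Qed.

Lemma tau_conj_act h p :
  (tau s \o (g \o tau s^-1%g)) (pact h p) =
  pact h ((tau s \o (g \o tau s^-1%g)) p).
Proof.
rewrite /= !tau_act gfun_act tau_act; congr (pact _ _).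
by apply: (@pact_free _ _ _ _ _ _ P _ _ p); rewrite -{1}(tauVK s p) -!tau_act tauVK.
Qed.

Lemma tau_conj_proj p : pproj ((tau s \o (g \o tau s^-1%g)) p) = pproj p.
Proof. by rewrite /= tau_cover gfun_proj -(tau_cover tau) tauVK. Qed.

Definition alpha : gauge P :=
  Gauge (tau_conj_smooth (gfun_smooth g)) (tau_conj_smooth (ginv_smooth g))
    (tau_conjK (@gfunK _ _ _ _ _ _ _ g)) (tau_conjK (@ginvK _ _ _ _ _ _ _ g))
    tau_conj_act tau_conj_proj.

End Alpha.

Definition beta (s : S) (H : distribution P) : distribution P :=
  push_distribution (tau s) H.

Local Open Scope group_scope.
Implicit Type u : S -> gauge P.

Definition gauge_cochain u (s t : S) : gauge P :=
  u s * alpha s (u t) * (u (s * t))^-1.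

Definition modifying_family u : Prop :=
  u 1 = 1 /\ forall s t, central_gauge P (gauge_cochain u s t).

(* [c_u], with values in the centre of [K]. *)
Definition associated_cocycle u (s t : S) : K :=
  xget 1 [set z | group_center z /\ gauge_of_center P z = gauge_cochain u s t].

Definition alpha_mod u (s : S) (g : gauge P) : gauge P :=
  u s * alpha s g * (u s)^-1.

Definition beta_mod u (s : S) (H : distribution P) : distribution P :=
  gauge_act (u s) (beta s H).

Definition twist (b u : S -> gauge P) : S -> gauge P := fun s => b s * u s.

(* [F] stands for the set of irreducible connections under consideration. *)
Variable F : set (distribution P).

Definition moduli_fixed : set (set (distribution P)) :=
  [set O | exists2 A, F A & O = gauge_orbit A /\ forall s, beta s @` O = O].

(* The class of [c_u] is independent of the choice of [A] in the orbit and of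
   [u]: the union over all choices of the classes so obtained is that class. *)
Definition type_map (O : set (distribution P)) : set (S -> S -> K) :=
  [set c | exists A u, [/\ O A, u 1 = 1, forall s, gauge_act (u s) (beta s A) = A
     & class2 (@group_center K) th (associated_cocycle u) c]].

Definition gauge_fixed u : set (gauge P) :=
  [set g | forall s, alpha_mod u s g = g].

(* The source of [j_{tau,u}] and [j_{tau,u}] itself, which sends the orbit of
   [A] under the fixed subgroup to the full orbit of [A]. *)
Definition fixed_moduli u : set (set (distribution P)) :=
  [set O | exists A, [/\ F A, forall s, beta_mod u s A = A
     & O = [set gauge_act g A | g in gauge_fixed u]]].

Definition j_map (O : set (distribution P)) : set (distribution P) :=
  \bigcup_(A in O) gauge_orbit A.

Definition im_j u : set (set (distribution P)) := j_map @` fixed_moduli u.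

Definition H1u u : set (set (S -> gauge P)) := H1 [set: gauge P] (alpha_mod u).

Definition H1central : set (set (S -> gauge P)) := H1 (central_gauge P) alpha.

(* The action of [H^1(S, Z(G_P))] on [H^1_u(S, G_P)]. *)
Definition H1_act u (a B : set (S -> gauge P)) : set (S -> gauge P) :=
  [set c | exists a0 b, [/\ a a0, B b
     & class1 [set: gauge P] (alpha_mod u) (fun s => a0 s * b s) c]].

Definition H1_orbit u (B : set (S -> gauge P)) : set (set (S -> gauge P)) :=
  [set H1_act u a B | a in H1central].

Definition H1_orbits u : set (set (set (S -> gauge P))) := H1_orbit u @` H1u u.

Definition H1_map u (a : set (S -> K)) : set (S -> gauge P) :=
  [set c | exists2 a0, a a0 & class1 [set: gauge P] (alpha_mod u)
                                (fun s => gauge_of_center P (a0 s)) c].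

Definition H1_kernel u : set (set (S -> K)) :=
  [set a | H1 (@group_center K) th a /\
     H1_map u a = class1 [set: gauge P] (alpha_mod u) (fun=> 1)].

End Equivariant.

(* Main.v *)
Require Import Defs.
From HB Require Import structures.
From mathcomp Require Import all_boot all_order all_algebra.
From mathcomp Require Import complex.
From mathcomp Require Import all_classical all_reals all_analysis.
Import Order.TTheory GRing.Theory Num.Theory numFieldNormedType.Exports.

Local Open Scope classical_set_scope.
Local Open Scope ring_scope.

(** Fix a set [F] of irreducible connections that is stable under the gauge
group.  Two facts drive everything.  First, irreducibility makes the gauge
orbit of [A] in [F] a torsor under the gauge group modulo its centre.  Secondly,
[beta_s (g . A) = alpha_s(g) . beta_s A].  Consequently, if [A] is fixed by the
action modified by [v] and [g . A] by the action modified by [w], then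
[w_s = g z_s v_s alpha_s(g)^-1] for a unique central cochain [z]
([fixed_torsor]), and conversely any such [w] fixes [g . A] ([fixed_conj]).
Such a change multiplies the cochain [c_v] by the coboundary of [z]
([gauge_cochain_conj]).

The three assertions read this relation in three ways.  The class of [c_v] does
not depend on the choice of [A] and [v], so it is the type of the orbit
([type_map_fixed]).  If an orbit has the type of [c_u], correcting [v] by a
central cochain gives [c_v = c_u], which says that [b_s = v_s u_s^-1] is a
cocycle for the action modified by [u] ([cocycle1_twist]); hence the orbit lies
in the image attached to [b], and in that of any other representative after
moving the connection ([type_fibre_subset]).  If it lies in the images attached
to [b] and [b'], then [c_v = c_u = c_w] forces [z] to be a cocycle, so that [b]
and [b'] have the same orbit under central cocycles ([im_j_disjoint]).

For the fibres, fix [A_0] fixed by the action modified by [u].  A fixed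
connection in the gauge orbit of [A_0] is some [g . A_0] with
[a_s = g^-1 alpha_u(g)] central; [a] is a central cocycle that becomes trivial
in the gauge group, and [g . A_0] matters up to the fixed subgroup exactly as
[a] matters up to coboundaries of central elements ([fibre_card]).

What differential geometry supplies is that gauge transformations preserve
connections, their curvature and irreducibility ([connection_push],
[curvature_push], [irreducible_push]), and that the bundle is not empty, because
the genus of [X] is positive ([betti_inhabited]); a point of the bundle shows
that a central gauge transformation determines the element of the centre of [K]
that it comes from. *)

(** * Smooth functions form an algebra *)

Section SmoothAlgebra.
Context {R : realType} {n : nat}.
Implicit Types (U : set 'rV[R]_n) (f g : 'rV[R]_n -> R).

(** Derivatives at a point of [U] only see the values of the function near this
point, hence on [U]. *)
Lemma Ck_eq U f g j : open U -> (forall x, U x -> f x = g x) ->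
  Ck j U f -> Ck j U g.
Proof.
move=> Uo; elim: j f g => [|j IH] f g fg /= [fc fd].
  split=> //; apply: subspace_eq_continuous fc => x; rewrite inE; exact: fg.
have near_fg x : U x -> \forall y \near x, f y = g y.
  by move=> Ux; apply: filterS (open_nbhs_nbhs (conj Uo Ux)).
split; first by apply: subspace_eq_continuous fc => x; rewrite inE; exact: fg.
move=> a; have [da ka] := fd a; split.
  by move=> x Ux; apply: near_eq_derivable (da x Ux); exact: near_fg.
by apply: IH ka => x Ux; apply: near_eq_derive; exact: near_fg.
Qed.

Lemma Ck_pred U f j : Ck j.+1 U f -> Ck j U f.
Proof.
elim: j f => [|j IH] f [fc fd]; first by split.
by split=> // a; have [da ka] := fd a; split=> //; exact: IH.
Qed.

Lemma Ck_cst U (c : R) j : Ck j U (fun=> c).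
Proof.
elim: j c => [|j IH] c /=.
  by split=> //; apply/subspace_continuousP => x _; exact: cvg_cst.
split; first by apply/subspace_continuousP => x _; exact: cvg_cst.
move=> a; split; first by move=> x _; exact: derivable_cst.
have -> : (fun x : 'rV[R]_n => 'D_a (fun=> c) x) = (fun=> 0); last exact: IH.
by apply/funext => x; rewrite derive_cst.
Qed.

Lemma Ck_add U f g j : open U -> Ck j U f -> Ck j U g ->
  Ck j U (fun x => f x + g x).
Proof.
move=> Uo; elim: j f g => [|j IH] f g [fc fd] [gc gd].
  split=> //; apply/subspace_continuousP => x Ux.
  move/subspace_continuousP/(_ x Ux): fc.
  move/subspace_continuousP/(_ x Ux): gc.
  by move=> gx fx; exact: (cvgD fx gx).
split.
  apply/subspace_continuousP => x Ux.
  move/subspace_continuousP/(_ x Ux): fc.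
  move/subspace_continuousP/(_ x Ux): gc.
  by move=> gx fx; exact: (cvgD fx gx).
move=> a; have [df kf] := fd a; have [dg kg] := gd a; split.
  by move=> x Ux; apply: derivableD; [exact: df|exact: dg].
apply: Ck_eq (IH _ _ kf kg) => // x Ux.
by apply/esym/deriveD; [exact: df|exact: dg].
Qed.

Lemma Ck_mul U f g j : open U -> Ck j U f -> Ck j U g ->
  Ck j U (fun x => f x * g x).
Proof.
move=> Uo; elim: j f g => [|j IH] f g fk gk; have [fc fd] := fk;
  have [gc gd] := gk.
  split=> //; apply/subspace_continuousP => x Ux.
  move/subspace_continuousP/(_ x Ux): fc.
  move/subspace_continuousP/(_ x Ux): gc.
  by move=> gx fx; exact: (cvgM fx gx).
split.
  apply/subspace_continuousP => x Ux.
  move/subspace_continuousP/(_ x Ux): fc.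
  move/subspace_continuousP/(_ x Ux): gc.
  by move=> gx fx; exact: (cvgM fx gx).
move=> a; have [df kf] := fd a; have [dg kg] := gd a; split.
  by move=> x Ux; apply: derivableM; [exact: df|exact: dg].
apply: Ck_eq (Ck_add _ _ _ _ Uo (IH _ _ (Ck_pred _ _ _ fk) kg)
   (IH _ _ (Ck_pred _ _ _ gk) kf)) => // x Ux.
by apply/esym/deriveM; [exact: df|exact: dg].
Qed.

Context {M : manifoldType R n}.
Implicit Types (h l : M -> R).

Lemma open_chart_image (c : chart R n M) : atlas c ->
  open (cmap c @` (setT `&` cdom c)).
Proof. by rewrite setTI => /mfd_chart[]. Qed.

Lemma smooth_cst (a : R) : smooth (fun _ : M => a).
Proof. by move=> c ac j; exact: Ck_cst. Qed.

Lemma smoothD h l : smooth h -> smooth l -> smooth (fun x => h x + l x).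
Proof.
move=> sh sl c ac j; apply: Ck_add; first exact: open_chart_image.
  exact: sh.
exact: sl.
Qed.

Lemma smoothM h l : smooth h -> smooth l -> smooth (fun x => h x * l x).
Proof.
move=> sh sl c ac j; apply: Ck_mul; first exact: open_chart_image.
  exact: sh.
exact: sl.
Qed.

End SmoothAlgebra.

(** * Push-forward of tangent vectors *)

Section PushForward.
Context {R : realType}.

Lemma smooth_pullback {m n : nat} {M : chartedType R m} {N : chartedType R n}
    (phi : M -> N) (h : N -> R) :
  smooth_map phi -> smooth h -> smooth (h \o phi).
Proof.
move=> [_ sphi] sh; have := sphi setT h openT sh.
by rewrite preimage_setT setTI.
Qed.

Lemma pushvE {m n : nat} {M : chartedType R m} {N : chartedType R n}
  (phi : M -> N) (v : tvec M) (h : N -> R) : smooth h ->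
  pushv phi v h = v (h \o phi).
Proof. by move=> sh; rewrite /pushv asboolT. Qed.

Lemma pushv_rough {m n : nat} {M : chartedType R m} {N : chartedType R n}
  (phi : M -> N) (v : tvec M) (h : N -> R) : ~ smooth h -> pushv phi v h = 0.
Proof. by move=> sh; rewrite /pushv asboolF. Qed.

Lemma pushv_comp {l m n : nat} {L : chartedType R l} {M : chartedType R m}
    {N : chartedType R n} (phi : M -> N) (psi : L -> M) (v : tvec L) :
  smooth_map phi -> pushv phi (pushv psi v) = pushv (phi \o psi) v.
Proof.
move=> sphi; apply/funext => h; have [sh|nsh] := pselect (smooth h).
  by rewrite !pushvE //; exact: smooth_pullback.
by rewrite !pushv_rough.
Qed.

Lemma pushv_id {n : nat} {M : chartedType R n} (p : M) (v : tvec M) :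
  tangent p v -> pushv id v = v.
Proof.
move=> [_ _ v0]; apply/funext => h; have [sh|nsh] := pselect (smooth h).
  by rewrite pushvE.
by rewrite pushv_rough // v0.
Qed.

Lemma pushv_lin {m n : nat} {M : chartedType R m} {N : chartedType R n}
    (phi : M -> N) (a : R) (v w : tvec M) :
  pushv phi ((a \*o v) \+ w) = (a \*o pushv phi v) \+ pushv phi w.
Proof.
apply/funext => h /=; have [sh|nsh] := pselect (smooth h).
  by rewrite !pushvE.
by rewrite !pushv_rough // mulr0 addr0.
Qed.

Lemma pushv_sub {m n : nat} {M : chartedType R m} {N : chartedType R n}
    (phi : M -> N) (v w : tvec M) :
  pushv phi (v \- w) = pushv phi v \- pushv phi w.
Proof.
apply/funext => h /=; have [sh|nsh] := pselect (smooth h).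
  by rewrite !pushvE.
by rewrite !pushv_rough // subr0.
Qed.

Lemma pushv0 {m n : nat} {M : chartedType R m} {N : chartedType R n}
    (phi : M -> N) : pushv phi (fun=> 0) = fun=> 0.
Proof. by apply/funext => h; rewrite /pushv; case: ifP. Qed.

(** Derivations are tested on smooth functions only, so this rests on sums and
products of smooth functions being smooth. *)
Lemma tangent_pushv {m n : nat} {M : chartedType R m} {N : manifoldType R n}
    (phi : M -> N) (p : M) (v : tvec M) :
  smooth_map phi -> tangent p v -> tangent (phi p) (pushv phi v).
Proof.
move=> sphi [vD vM v0]; split.
- move=> a f g sf sg; rewrite !pushvE //.
    by rewrite -vD //; exact: smooth_pullback.
  by apply: smoothD => //; apply: smoothM => //; exact: smooth_cst.
- move=> f g sf sg; rewrite !pushvE //; last exact: smoothM.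
  by rewrite -vM //; exact: smooth_pullback.
- by move=> f nsf; exact: pushv_rough.
Qed.

Lemma tangent_cst0 {n : nat} {M : manifoldType R n} (p : M) (v : tvec M) :
  tangent p v -> v (fun=> 0) = 0.
Proof.
move=> [vD _ _]; have := vD (-1) _ _ (smooth_cst 0) (smooth_cst 0).
under eq_fun do rewrite mulr0 addr0.
by rewrite mulN1r addNr.
Qed.

End PushForward.

(** * Transport of connections by gauge transformations *)

Section GaugeTransport.
Context {R : realType} {k n m : nat} {K : lieGroupType R k}.
Context {X : manifoldType R n} {P : principalBundle K X m}.
Implicit Types (g h : gauge P) (H : Defs.distribution P) (p q : P).
Implicit Types (V W : (P -> R) -> P -> R).

(** On such distributions the identity acts trivially: elements of [tvec] are
arbitrary functionals, and [pushv id] forgets their values on functions that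
are not smooth. *)
Definition tangential (H : Defs.distribution P) := forall p, H p `<=` tangent p.

Lemma push_distribution_comp (phi psi : P -> P) H : smooth_map phi ->
  push_distribution phi (push_distribution psi H) =
  push_distribution (phi \o psi) H.
Proof.
move=> sphi; apply/funext => q; apply/seteqP; split=> w.
  move=> [_ [_ [<- [p [v [<- Hv ->]]] ->]]].
  by exists p, v; split=> //; exact: pushv_comp.
move=> [p [v [<- Hv ->]]]; exists (psi p), (pushv psi v); split=> //.
  by exists p, v.
by rewrite pushv_comp.
Qed.

Lemma tangential_push (phi : P -> P) H : smooth_map phi -> tangential H ->
  tangential (push_distribution phi H).
Proof.
by move=> sphi tH _ _ [p [v [<- Hv ->]]]; apply: tangent_pushv => //; exact: tH.
Qed.

Lemma gauge_actM g h H : gauge_act (g * h)%g H = gauge_act g (gauge_act h H).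
Proof. by rewrite /gauge_act push_distribution_comp //; exact: gfun_smooth. Qed.

Lemma gauge_act1 H : tangential H -> gauge_act 1%g H = H.
Proof.
move=> tH; apply/funext => q; apply/seteqP; split=> w.
  move=> [p [v [<- Hv ->]]].
  by rewrite (_ : gfun 1%g = id) // (pushv_id p) //; exact: tH.
move=> Hw; exists q, w; split => //.
by rewrite (_ : gfun 1%g = id) // (pushv_id q) //; exact: tH.
Qed.

Lemma gauge_actK g H : tangential H -> gauge_act g^-1%g (gauge_act g H) = H.
Proof. by move=> tH; rewrite -gauge_actM mulVg gauge_act1. Qed.

Lemma gauge_actE g H q : gauge_act g H q = pushv g @` H (ginv g q).
Proof.
apply/seteqP; split=> w.
  by move=> [p [v [<- Hv ->]]]; exists v => //; rewrite gfunK.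
by move=> [v Hv <-]; exists (ginv g q), v; split=> //; exact: ginvK.
Qed.

Lemma pushv_gfunK g p v : tangent p v -> pushv (ginv g) (pushv g v) = v.
Proof.
move=> tv; rewrite pushv_comp; last exact: ginv_smooth.
by rewrite (_ : _ \o _ = id) ?(pushv_id p) //; apply/funext => x; exact: gfunK.
Qed.

Lemma pushv_ginvK g p v : tangent p v -> pushv g (pushv (ginv g) v) = v.
Proof. exact: (pushv_gfunK (g^-1)%g). Qed.

Lemma pushv_pproj g (v : tvec P) :
  pushv (@pproj _ _ _ _ _ _ P) (pushv g v) = pushv (@pproj _ _ _ _ _ _ P) v.
Proof.
rewrite pushv_comp; last exact: pproj_smooth.
by congr (pushv _ v); apply/funext => p; exact: gfun_proj.
Qed.

Lemma vertical_push g p v : vertical p v -> vertical (g p) (pushv g v).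
Proof.
move=> [tv v0]; split; last by rewrite pushv_pproj.
by apply: tangent_pushv => //; exact: gfun_smooth.
Qed.

Lemma fundamental_push g (zeta : tvec K) p :
  pushv g (fundamental zeta p) = fundamental zeta (g p).
Proof.
rewrite /fundamental pushv_comp; last exact: gfun_smooth.
by congr (pushv _ zeta); apply/funext => x /=; rewrite gfun_act.
Qed.

Definition push_vfield g (V : (P -> R) -> P -> R) : (P -> R) -> P -> R :=
  fun f q => pushv g (vat V (ginv g q)) f.

Lemma push_vfieldE g V f : smooth f ->
  push_vfield g V f = V (f \o g) \o ginv g.
Proof. by move=> sf; apply/funext => q; rewrite /push_vfield pushvE. Qed.

Lemma push_vfield_rough g V f : ~ smooth f -> push_vfield g V f = fun=> 0.
Proof. by move=> sf; apply/funext => q; rewrite /push_vfield pushv_rough. Qed.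

Lemma vat_push_vfield g V p :
  vat (push_vfield g V) (g p) = pushv g (vat V p).
Proof. by rewrite /vat /push_vfield gfunK. Qed.

Lemma vfield_push g V : vfield V -> vfield (push_vfield g V).
Proof.
move=> [tV sV]; split=> [q|f sf].
  rewrite -(ginvK g q) vat_push_vfield.
  by apply: tangent_pushv => //; exact: gfun_smooth.
rewrite push_vfieldE //; apply: smooth_pullback; first exact: ginv_smooth.
by apply: sV; apply: smooth_pullback => //; exact: gfun_smooth.
Qed.

Lemma push_vfieldK g V : vfield V -> push_vfield g (push_vfield g^-1%g V) = V.
Proof.
move=> [tV _]; apply/funext => f; apply/funext => q.
rewrite -[LHS]/(vat _ q f) -{1}(ginvK g q) vat_push_vfield.
have -> : ginv g q = gfun g^-1%g q by [].
by rewrite vat_push_vfield (pushv_ginvK _ q).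
Qed.

Lemma vfield_cst0 V : vfield V -> V (fun=> 0) = fun=> 0.
Proof.
by move=> [tV _]; apply/funext => p; exact: (tangent_cst0 _ _ (tV p)).
Qed.

(** On a smooth [f] both sides are the commutator of [V] and [W] evaluated at
[f \o g]; on other functions both sides vanish. *)
Lemma lie_bracket_push g V W p : vfield V -> vfield W ->
  pushv g (vat (lie_bracket V W) p) =
  vat (lie_bracket (push_vfield g V) (push_vfield g W)) (g p).
Proof.
move=> vV vW; apply/funext => f; rewrite /vat /lie_bracket /=.
have [sf|nsf] := pselect (smooth f); last first.
  rewrite pushv_rough // !(push_vfield_rough _ _ f) //.
  by rewrite !vfield_cst0 ?subrr //; exact: vfield_push.
have sfg : smooth (f \o g) by apply: smooth_pullback => //; exact: gfun_smooth.
have key (V' W' : (P -> R) -> P -> R) : vfield W' ->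
    push_vfield g V' (push_vfield g W' f) (g p) = V' (W' (f \o g)) p.
  move=> vW'; have [_ sW'] := vfield_push g _ vW'.
  rewrite push_vfieldE; last exact: sW'.
  rewrite /= gfunK push_vfieldE //; congr (V' _ p).
  by apply/funext => x /=; rewrite gfunK.
by rewrite pushvE // /= !key.
Qed.

(** A gauge transformation is a diffeomorphism that commutes with the projection
and with [K], hence preserves every piece of structure in the definition. *)
Lemma connection_push g H : connection H -> connection (gauge_act g H).
Proof.
move=> [tH linH splitH equivH smoothH].
have tgH : tangential (gauge_act g H).
  by apply: tangential_push => //; exact: gfun_smooth.
split=> //.
- move=> q; rewrite gauge_actE; have [H0 HD] := linH (ginv g q); split.
    by exists (fun=> 0) => //; exact: pushv0.
  move=> a _ _ [v Hv <-] [w Hw <-]; exists ((a \*o v) \+ w); first exact: HD.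
  exact: pushv_lin.
- move=> q v tv; have tv1 : tangent (ginv g q) (pushv (ginv g) v).
    by apply: tangent_pushv => //; exact: ginv_smooth.
  have [h1 [[Hh1 vh1] uniqh]] := splitH _ _ tv1.
  exists (pushv g h1); split; first split.
  + by rewrite gauge_actE; exists h1.
  + rewrite -{1}(pushv_ginvK g q v tv) -pushv_sub -(ginvK g q).
    exact: vertical_push.
  + move=> h'; rewrite gauge_actE => -[[h2 Hh2 <-] vh2]; congr pushv.
    apply: uniqh; split=> //.
    rewrite -(pushv_gfunK g (ginv g q) h2); last exact: tH.
    rewrite -pushv_sub -[ginv g]/(gfun g^-1%g).
    exact: vertical_push.
- move=> h q; rewrite !gauge_actE ginv_act equivH.
  rewrite !image_comp; apply: eq_imagel => v _ /=.
  rewrite !pushv_comp; [|exact: pact_smoothl|exact: gfun_smooth].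
  by congr (pushv _ v); apply/funext => x /=; rewrite gfun_act.
- move=> V vV; have [W vW HW] := smoothH _ (vfield_push g^-1%g _ vV).
  exists (push_vfield g W); first exact: vfield_push.
  move=> q; have [Hq Vq] := HW (ginv g q).
  rewrite -(ginvK g q) vat_push_vfield; split.
    by rewrite gauge_actE gfunK; exists (vat W (ginv g q)).
  rewrite -(push_vfieldK g V vV) vat_push_vfield -pushv_sub.
  exact: vertical_push.
Qed.

(** Horizontal fields for [g . H] are pulled back to horizontal fields for [H];
the bracket and the fundamental fields are natural, and the curvature form does
not see [g] because it comes from the base. *)
Lemma curvature_push g (om : X -> tvec X -> tvec X -> R) (xi : tvec K) H :
  tangential H -> has_curvature om xi H -> has_curvature om xi (gauge_act g H).
Proof.
move=> tH curvH.
have pull V : horizontal_vfield (gauge_act g H) V ->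
    horizontal_vfield H (push_vfield g^-1%g V).
  move=> [vV hV]; split; first exact: vfield_push.
  move=> p; rewrite -{2}(gfunK g p) -[ginv g (g p)]/(gfun g^-1%g (g p)).
  rewrite vat_push_vfield; have := hV (g p); rewrite gauge_actE gfunK.
  by move=> [v Hv <-]; rewrite (pushv_gfunK g p) //; exact: tH.
move=> V W hV hW q; have [vV _] := hV; have [vW _] := hW.
have := curvH _ _ (pull V hV) (pull W hW) (ginv g q).
have push_vat U : vat (push_vfield g^-1%g U) (ginv g q) =
    pushv (ginv g) (vat U q) by exact: (vat_push_vfield (g^-1)%g).
rewrite !push_vat -[ginv g]/(gfun g^-1%g) !pushv_pproj gfun_proj.
set zeta := _ \*o xi => -[lzeta Hzeta]; split=> //.
rewrite gauge_actE; eexists; first exact: Hzeta.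
rewrite pushv_sub fundamental_push lie_bracket_push; [|exact: vfield_push..].
by rewrite !push_vfieldK // ginvK.
Qed.

End GaugeTransport.

(** * Cohomology classes *)

(** Normal form of words in a free group: left-associated and reduced. *)
Ltac group_simpl :=
  rewrite ?(invgM, invgK, invg1, mulgA, mulgK, mulgVK, mulgV, mulVg, mul1g,
            mulg1).

Section CohomologyClasses.
Context {S G : groupType} {C : set G} {act : S -> G -> G}.
Hypothesis C_subgroup : subgroup C.
Hypothesis act_hom : forall s, group_hom (act s).
Local Open Scope group_scope.

Lemma group_hom1 s : act s 1 = 1.
Proof. by apply: (mulgI (act s 1)); rewrite -act_hom !mulg1. Qed.

Lemma group_homV s x : act s x^-1 = (act s x)^-1.
Proof. by apply: (mulgI (act s x)); rewrite -act_hom !mulgV group_hom1. Qed.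

Lemma class1_refl {b : S -> G} : cocycle1 C act b -> class1 C act b b.
Proof.
move=> cb; split=> //; have [C1 _ _] := C_subgroup.
by exists 1 => // s; rewrite group_hom1; group_simpl.
Qed.

Lemma class1_eq {b b' : S -> G} :
  class1 C act b b' -> class1 C act b = class1 C act b'.
Proof.
have [_ CM CV] := C_subgroup.
move=> [_ [g Cg b'E]]; apply/seteqP; split=> c [cc [h Ch cE]]; split=> //.
  exists (h * g^-1); first by apply: CM => //; exact: CV.
  by move=> s; rewrite b'E cE act_hom group_homV; group_simpl.
exists (h * g); first exact: CM.
by move=> s; rewrite cE b'E act_hom; group_simpl.
Qed.

Hypothesis C_comm : forall x y : G, C x -> C y -> x * y = y * x.
Hypothesis act_C : forall s x, C x -> C (act s x).

Lemma class2_refl {c : S -> S -> G} : cocycle2 C act c -> class2 C act c c.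
Proof.
move=> cc; split=> //; have [C1 _ _] := C_subgroup.
by exists (fun=> 1); split=> // s t; rewrite group_hom1; group_simpl.
Qed.

Definition coboundary (z : S -> G) (s t : S) : G :=
  z s * act s (z t) * (z (s * t))^-1.

Lemma coboundaryM (w z : S -> G) s t :
  (forall s, C (w s)) -> (forall s, C (z s)) ->
  coboundary (fun s => w s * z s) s t = coboundary w s t * coboundary z s t.
Proof.
have [_ CM CV] := C_subgroup.
have ACA x y x' y' : C x -> C y -> C x' -> C y' ->
    x * y * (x' * y') = x * x' * (y * y').
  move=> Cx Cy Cx' Cy'.
  by rewrite !mulgA -(mulgA x) (C_comm y) // !mulgA.
move=> Cw Cz; rewrite /coboundary act_hom.
rewrite (C_comm (w (s * t))) // invgM.
have Cwt := act_C s _ (Cw t); have Czt := act_C s _ (Cz t).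
rewrite (ACA (w s)) // (ACA (w s * _)) //.
- by apply: (CM).
- by apply: CV.
- by apply: (CM).
- by apply: CV.
Qed.

(** The coboundary map is a morphism on cochains with values in the abelian
subgroup [C]. *)
Lemma class2_eq {c c' : S -> S -> G} :
  class2 C act c c' -> class2 C act c = class2 C act c'.
Proof.
have [_ CM CV] := C_subgroup.
move=> [_ [z [Cz z1 c'E]]].
apply/seteqP; split=> d [cd [w [Cw w1 dE]]]; split=> //.
  have CVz s : C (z s)^-1 by exact: CV.
  exists (fun s => w s * (z s)^-1); split=> [s||s t].
  - exact: CM.
  - by rewrite w1 z1 invg1 mulg1.
  - rewrite dE c'E mulgA; congr (_ * _).
    rewrite -[LHS]/(coboundary w s t).
    rewrite -[RHS]/(coboundary (fun s => w s * (z s)^-1) s t *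
      coboundary z s t).
    rewrite (coboundaryM w (fun s => (z s)^-1)) // -mulgA.
    rewrite -(coboundaryM (fun s => (z s)^-1) z) //.
    have -> : coboundary (fun s => (z s)^-1 * z s) s t = 1.
      by rewrite /coboundary !mulVg group_hom1; group_simpl.
    by rewrite mulg1.
exists (fun s => w s * z s); split=> [s||s t].
- exact: CM.
- by rewrite w1 z1 mulg1.
- rewrite dE c'E mulgA; congr (_ * _).
  by rewrite -[RHS]/(coboundary (fun s => w s * z s) s t) coboundaryM.
Qed.

End CohomologyClasses.

(** * The centre of the gauge group *)

Section Equivariance.
Context {R : realType} {k n m : nat} {K : lieGroupType R k}.
Context {X : manifoldType R n} {P : principalBundle K X m}.
Context {S : groupType} {rho : S -> X -> X} {th : S -> K -> K}.
Context {tau : equivariantStructure P rho th}.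
Variable p0 : P.
Local Open Scope group_scope.

Local Notation ZK := (@group_center K).
Local Notation ZG := (central_gauge P).
Local Notation gc := (gauge_of_center P).

(** The action of [K] on the bundle is free, so identities for [th] can be
checked on the orbit of the base point [p0]. *)
Lemma th_hom s : group_hom (th s).
Proof.
move=> x y; apply: (@pact_free _ _ _ _ _ _ P _ _ (tau s p0)).
by rewrite -tau_act pactM !tau_act pactM.
Qed.

Lemma th_comp s t x : th (s * t) x = th s (th t x).
Proof.
apply: (@pact_free _ _ _ _ _ _ P _ _ (tau (s * t) p0)).
by rewrite -tau_act -!tauM !tau_act.
Qed.

Lemma th_id x : th 1 x = x.
Proof.
apply: (@pact_free _ _ _ _ _ _ P _ _ p0).
by rewrite -{1}(tau1 tau p0) -tau_act !tau1.
Qed.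

Lemma center_subgroup : subgroup ZK.
Proof.
split=> [x|x y zx zy z|x zx z].
    by rewrite mulg1 mul1g.
  by rewrite -mulgA (zy z) mulgA (zx z) mulgA.
by apply: (mulgI x); rewrite mulgA mulgV mul1g mulgA (zx z) mulgK.
Qed.

Lemma center_comm (x y : K) : ZK x -> ZK y -> x * y = y * x.
Proof. by move=> zx _; exact: zx. Qed.

(** [th s] is bijective and multiplicative. *)
Lemma th_center s z : ZK z -> ZK (th s z).
Proof.
move=> zz x; have -> : x = th s (th s^-1 x) by rewrite -th_comp mulgV th_id.
by rewrite -!th_hom zz.
Qed.

Lemma gauge_of_centerE z p : ZK z -> gc z p = pact z p.
Proof. by move=> zz; rewrite /gauge_of_center; case: pselect. Qed.

Lemma gauge_of_center_inj z w : ZK z -> ZK w -> gc z = gc w -> z = w.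
Proof.
move=> zz zw zwE; apply: (@pact_free _ _ _ _ _ _ P _ _ p0).
by rewrite -!gauge_of_centerE // zwE.
Qed.

Lemma gauge_of_centerM z w : ZK z -> ZK w -> gc (z * w) = gc z * gc w.
Proof.
move=> zz zw; have [_ ZM _] := center_subgroup.
apply: gauge_eq => p; rewrite gauge_of_centerE; last exact: ZM.
by rewrite pactM -[RHS]/(gc z (gc w p)) !gauge_of_centerE.
Qed.

Lemma gauge_of_center1 : gc 1 = 1.
Proof.
have [Z1 _ _] := center_subgroup.
by apply: gauge_eq => p; rewrite gauge_of_centerE // pact1.
Qed.

Lemma gauge_of_centerV z : ZK z -> gc z^-1 = (gc z)^-1.
Proof.
move=> zz; have [_ _ ZV] := center_subgroup; have zV := ZV _ zz.
apply: (mulgI (gc z)).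
by rewrite -gauge_of_centerM // !mulgV gauge_of_center1.
Qed.

Lemma central_gauge_comm c (g : gauge P) : ZG c -> c * g = g * c.
Proof.
move=> [z zz <-]; apply: gauge_eq => p.
rewrite -[LHS]/(gc z (g p)) -[RHS]/(g (gc z p)).
by rewrite !gauge_of_centerE // gfun_act.
Qed.

Lemma central_subgroup : subgroup ZG.
Proof.
have [Z1 ZM ZV] := center_subgroup; split.
- by exists 1 => //; exact: gauge_of_center1.
- by move=> _ _ [z zz <-] [w zw <-]; exists (z * w); [exact: ZM|
    exact: gauge_of_centerM].
- by move=> _ [z zz <-]; exists z^-1; [exact: ZV|exact: gauge_of_centerV].
Qed.

Lemma central_gauge_conj c (g : gauge P) : ZG c -> g * c * g^-1 = c.
Proof. by move=> /(central_gauge_comm _ g) <-; rewrite mulgK. Qed.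

Lemma alpha_hom s : group_hom (alpha tau s).
Proof. by move=> g h; apply: gauge_eq => p /=; rewrite tauK. Qed.

Lemma alpha1 s : alpha tau s 1 = 1.
Proof. exact: (group_hom1 alpha_hom). Qed.

Lemma alphaV s g : alpha tau s g^-1 = (alpha tau s g)^-1.
Proof. exact: (group_homV alpha_hom). Qed.

Lemma alpha_comp s t g : alpha tau (s * t) g = alpha tau s (alpha tau t g).
Proof. by apply: gauge_eq => p /=; rewrite invgM !tauM. Qed.

Lemma alpha_id g : alpha tau 1 g = g.
Proof. by apply: gauge_eq => p /=; rewrite invg1 !tau1. Qed.

Lemma alpha_gauge_of_center s z : ZK z ->
  alpha tau s (gc z) = gc (th s z).
Proof.
move=> zz; apply: gauge_eq => p /=.
rewrite !gauge_of_centerE ?tau_act ?tauVK //; exact: th_center.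
Qed.

Lemma alpha_central s c : ZG c -> ZG (alpha tau s c).
Proof.
move=> [z zz <-]; rewrite alpha_gauge_of_center //.
by exists (th s z) => //; exact: th_center.
Qed.

End Equivariance.

(** * Modifying families *)

Section ModifiedActions.
Context {R : realType} {k n m : nat} {K : lieGroupType R k}.
Context {X : manifoldType R n} {P : principalBundle K X m}.
Context {S : groupType} {rho : S -> X -> X} {th : S -> K -> K}.
Context {tau : equivariantStructure P rho th}.
Variable p0 : P.
Local Open Scope group_scope.
Implicit Types (u v z b : S -> gauge P) (g h : gauge P).

Local Notation ZK := (@group_center K).
Local Notation ZG := (central_gauge P).
Local Notation gc := (gauge_of_center P).

Lemma central_mulACA c g h l : ZG c -> g * c * (h * l) = g * h * (c * l).
Proof.
by move=> Zc; rewrite !mulgA -(mulgA g) (central_gauge_comm _ h Zc) mulgA.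
Qed.

(** The central factors [z_s] move out, [alpha_s(g)^-1] cancels against
[alpha_s(g)], and what remains is a central element conjugated by [g]. *)
Lemma gauge_cochain_conj u v z g :
  modifying_family tau v -> (forall s, ZG (z s)) ->
  (forall s, u s = g * z s * v s * (alpha tau s g)^-1) ->
  forall s t, gauge_cochain tau u s t =
    coboundary (act := alpha tau) z s t * gauge_cochain tau v s t.
Proof.
move=> [_ Zv] Zz uE s t; have [Z1 ZM ZV] := central_subgroup (P := P).
have Zaz := alpha_central p0 (tau := tau) s _ (Zz t).
have Zd : ZG (coboundary (act := alpha tau) z s t).
  by apply: (ZM); [apply: (ZM) => //|exact: ZV].
rewrite -(central_gauge_conj _ g (ZM _ _ Zd (Zv s t))).
rewrite /coboundary -(mulgA (z s * _)).
rewrite (central_gauge_comm _ (gauge_cochain tau v s t) (ZV _ (Zz (s * t)))).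
rewrite /gauge_cochain !uE !alpha_hom alpha_comp !alphaV; group_simpl.
by rewrite -(mulgA (g * z s)) -(central_gauge_comm _ (v s) Zaz); group_simpl.
Qed.

Lemma alpha_mod_hom u s : group_hom (alpha_mod tau u s).
Proof. by move=> g h; rewrite /alpha_mod alpha_hom; group_simpl. Qed.

Lemma alpha_mod_central u s c : ZG c -> alpha_mod tau u s c = alpha tau s c.
Proof.
by move=> Zc; rewrite /alpha_mod central_gauge_conj //; exact: alpha_central.
Qed.

Lemma alpha_mod1 u g : modifying_family tau u -> alpha_mod tau u 1 g = g.
Proof. by move=> [u1 _]; rewrite /alpha_mod u1 alpha_id; group_simpl. Qed.

(** The failure of [u] to be multiplicative is [c_u], which is central and
therefore acts trivially by conjugation. *)
Lemma alpha_mod_comp u s t g : modifying_family tau u ->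
  alpha_mod tau u s (alpha_mod tau u t g) = alpha_mod tau u (s * t) g.
Proof.
move=> [_ Zu]; rewrite /alpha_mod !alpha_hom alphaV -alpha_comp.
have uE : u s * alpha tau s (u t) = gauge_cochain tau u s t * u (s * t).
  by rewrite /gauge_cochain mulgVK.
set w := u (s * t) * alpha tau (s * t) g * (u (s * t))^-1.
transitivity (gauge_cochain tau u s t * w * (gauge_cochain tau u s t)^-1).
  transitivity ((u s * alpha tau s (u t)) * alpha tau (s * t) g *
                (u s * alpha tau s (u t))^-1); first by group_simpl.
  by rewrite uE /w; group_simpl.
by rewrite (central_gauge_comm _ w (Zu s t)) mulgK.
Qed.

Lemma twist_cochain u b s t : modifying_family tau u ->
  gauge_cochain tau (twist b u) s t =
  b s * alpha_mod tau u s (b t) * (b (s * t))^-1 * gauge_cochain tau u s t.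
Proof.
move=> [_ Zu]; rewrite -mulgA -(central_gauge_comm _ _ (Zu s t)).
rewrite /gauge_cochain /twist /alpha_mod alpha_hom.
have -> : (b (s * t) * u (s * t))^-1 = (u (s * t))^-1 * (b (s * t))^-1.
  exact: invgM.
by group_simpl.
Qed.

(** The cocycles for the action modified by [u] are the differences between [u]
and the modifying families that have the same cochain as [u]. *)
Lemma cocycle1_twist u b : modifying_family tau u ->
  cocycle1 [set: gauge P] (alpha_mod tau u) b <->
  b 1 = 1 /\
  forall s t, gauge_cochain tau (twist b u) s t = gauge_cochain tau u s t.
Proof.
move=> mu; split=> [[_ b1 bM]|[b1 bE]].
  by split=> // s t; rewrite twist_cochain // -bM mulgV mul1g.
split=> // s t; have := bE s t; rewrite twist_cochain // => /esym.
rewrite -{1}(mul1g (gauge_cochain tau u s t)) => /mulIg /esym.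
by move=> e; rewrite -[LHS]mul1g -e mulgVK.
Qed.

Lemma twist_modifying u b : modifying_family tau u ->
  cocycle1 [set: gauge P] (alpha_mod tau u) b ->
  modifying_family tau (twist b u).
Proof.
move=> mu /cocycle1_twist[] // b1 bE; have [u1 Zu] := mu; split.
  by rewrite /twist b1 u1 mulg1.
by move=> s t; rewrite bE.
Qed.

Lemma associated_cocycleP u s t : modifying_family tau u ->
  ZK (associated_cocycle tau u s t) /\
  gc (associated_cocycle tau u s t) = gauge_cochain tau u s t.
Proof.
move=> [_ Zu]; have [z zz zE] := Zu s t.
exact: (@xgetPex _ 1 [set z | ZK z /\ gc z = gauge_cochain tau u s t]
  (ex_intro _ z (conj zz zE))).
Qed.

Lemma gauge_cochain_cocycle u r s t : modifying_family tau u ->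
  gauge_cochain tau u r s * gauge_cochain tau u (r * s) t =
  alpha tau r (gauge_cochain tau u s t) * gauge_cochain tau u r (s * t).
Proof.
move=> [_ Zu].
have Zc := alpha_central p0 (tau := tau) r _ (Zu s t).
rewrite {4}/gauge_cochain !mulgA (central_gauge_comm _ (u r) Zc).
rewrite /gauge_cochain !alpha_hom alphaV alpha_comp.
by group_simpl.
Qed.

Lemma associated_cocycle2 u : modifying_family tau u ->
  cocycle2 ZK th (associated_cocycle tau u).
Proof.
move=> mu; have [Z1 ZM ZV] := center_subgroup (K := K); have [u1 _] := mu.
have acZ s t := (associated_cocycleP u s t mu).1.
have acE s t := (associated_cocycleP u s t mu).2.
split=> [//|s|r s t].
  split; apply: (gauge_of_center_inj p0) => //; rewrite acE gauge_of_center1 //.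
    by rewrite /gauge_cochain u1 alpha_id mul1g mul1g mulgV.
  by rewrite /gauge_cochain u1 alpha1 !mulg1 mulgV.
apply: (gauge_of_center_inj p0).
- by apply: (ZM).
- by apply: (ZM) => //; apply: (th_center p0 (tau := tau)).
rewrite !gauge_of_centerM // ?acE; last exact: (th_center p0 (tau := tau)).
rewrite -(alpha_gauge_of_center p0 (tau := tau)) // acE.
exact: gauge_cochain_cocycle.
Qed.

Lemma central_lift z : (forall s, ZG (z s)) -> z 1 = 1 ->
  exists zeta : S -> K, [/\ forall s, ZK (zeta s), zeta 1 = 1 &
    forall s, gc (zeta s) = z s].
Proof.
move=> Zz z1; have [Z1 _ _] := center_subgroup (K := K).
pose zeta s := xget 1 [set x | ZK x /\ gc x = z s].
have zetaP s : ZK (zeta s) /\ gc (zeta s) = z s.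
  have [x zx xE] := Zz s.
  exact: (@xgetPex _ 1 [set x | ZK x /\ gc x = z s]
    (ex_intro _ x (conj zx xE))).
exists zeta; split=> [s||s]; [exact: (zetaP s).1| |exact: (zetaP s).2].
apply: (gauge_of_center_inj p0) => //; first exact: (zetaP 1).1.
by rewrite gauge_of_center1 (zetaP 1).2.
Qed.

(** Cohomologous cochains in the centre of the gauge group come from
cohomologous cochains in the centre of [K]. *)
Lemma class2_associated u v z :
  modifying_family tau u -> modifying_family tau v ->
  (forall s, ZG (z s)) -> z 1 = 1 ->
  (forall s t, gauge_cochain tau u s t =
     coboundary (act := alpha tau) z s t * gauge_cochain tau v s t) ->
  class2 ZK th (associated_cocycle tau v) =
  class2 ZK th (associated_cocycle tau u).
Proof.
move=> mu mv Zz z1 uE; have [zeta [Zzeta zeta1 zetaE]] := central_lift z Zz z1.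
have [Z1 ZM ZV] := center_subgroup (K := K).
have thZ := th_center p0 (tau := tau).
apply: (class2_eq center_subgroup (th_hom p0 (tau := tau)) center_comm thZ).
split; first exact: associated_cocycle2.
exists zeta; split=> // s t.
have [av avE] := associated_cocycleP v s t mv.
have [au auE] := associated_cocycleP u s t mu.
have Zt := thZ s _ (Zzeta t). have Zst := ZV _ (Zzeta (s * t)).
have ZZ := ZM _ _ (Zzeta s) Zt.
have ZZZ := ZM _ _ ZZ Zst.
apply: (gauge_of_center_inj p0) => //; first by apply: (ZM).
rewrite !gauge_of_centerM // gauge_of_centerV //.
rewrite -(alpha_gauge_of_center p0 (tau := tau)) //.
by rewrite avE auE !zetaE uE.
Qed.

(** * Orbits of central cocycles in the first cohomology set *)

(** The class of [b'] is that of [b] moved by the central cochain [a]. *)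
Definition cohomologous_twisted u (a b b' : S -> gauge P) :=
  exists g, forall s, b' s = g * (a s * b s) * (alpha_mod tau u s g)^-1.

Lemma cocycle1_central_mul u a b : modifying_family tau u ->
  cocycle1 ZG (alpha tau) a -> cocycle1 [set: gauge P] (alpha_mod tau u) b ->
  cocycle1 [set: gauge P] (alpha_mod tau u) (fun s => a s * b s).
Proof.
move=> mu [Za a1 aM] [_ b1 bM]; split=> // [|s t].
  by rewrite a1 b1 mulg1.
rewrite aM bM alpha_mod_hom (alpha_mod_central u s (a t)) //.
by apply: central_mulACA; exact: (alpha_central p0 (tau := tau)).
Qed.

Lemma central_cocycleM (a b : S -> gauge P) :
  cocycle1 ZG (alpha tau) a -> cocycle1 ZG (alpha tau) b ->
  cocycle1 ZG (alpha tau) (fun s => a s * b s).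
Proof.
have [Z1 ZM ZV] := central_subgroup (P := P).
move=> [Za a1 aM] [Zb b1 bM]; split=> [s||s t].
- exact: ZM.
- by rewrite a1 b1 mulg1.
rewrite aM bM alpha_hom.
by apply: central_mulACA; exact: (alpha_central p0 (tau := tau)).
Qed.

Lemma central_cocycleV (a : S -> gauge P) :
  cocycle1 ZG (alpha tau) a ->
  cocycle1 ZG (alpha tau) (fun s => (a s)^-1).
Proof.
have [Z1 ZM ZV] := central_subgroup (P := P).
move=> [Za a1 aM]; split=> [s||s t].
- exact: ZV.
- by rewrite a1 invg1.
by rewrite aM invgM alphaV (central_gauge_comm _ _ (ZV _ (Za s))).
Qed.

Lemma setT_subgroup (G : groupType) : subgroup [set: G].
Proof. by []. Qed.

(** The action of classes can be computed on representatives because [alpha_mod]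
and [alpha] agree on the centre. *)
Lemma H1_act_class u a b : modifying_family tau u ->
  cocycle1 ZG (alpha tau) a -> cocycle1 [set: gauge P] (alpha_mod tau u) b ->
  H1_act tau u (class1 ZG (alpha tau) a)
      (class1 [set: gauge P] (alpha_mod tau u) b) =
  class1 [set: gauge P] (alpha_mod tau u) (fun s => a s * b s).
Proof.
move=> mu ca cb; have TG := setT_subgroup (gauge P).
apply/seteqP; split=> c.
  move=> [a0 [b0 [[ca0 [w Zw a0E]] [cb0 [h _ b0E]] abc]]].
  rewrite (class1_eq TG (alpha_mod_hom u) (b' := fun s => a0 s * b0 s)) //.
  split; first exact: cocycle1_central_mul.
  exists (w * h) => // s.
  rewrite a0E b0E alpha_mod_hom (alpha_mod_central u s w) //.
  have [Z1 ZM ZV] := central_subgroup (P := P).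
  have Zaw := ZV _ (alpha_central p0 (tau := tau) s _ Zw).
  have [Za _ _] := ca.
  rewrite -(mulgA w) -(mulgA h) central_mulACA; last by apply: (ZM).
  rewrite (central_mulACA (alpha tau s w)^-1 (a s)) //.
  rewrite (central_gauge_comm _ (alpha_mod tau u s h)^-1) //.
  by rewrite (invgM (alpha tau s w)) !mulgA.
by move=> ?; exists a, b; split=> //; apply: class1_refl => //;
  [exact: central_subgroup|exact: alpha_hom|exact: alpha_mod_hom].
Qed.

Lemma H1_orbit_mem u b0 B b : modifying_family tau u ->
  cocycle1 [set: gauge P] (alpha_mod tau u) b0 ->
  H1_orbit tau u (class1 [set: gauge P] (alpha_mod tau u) b0) B -> B b ->
  cocycle1 [set: gauge P] (alpha_mod tau u) b /\
  exists a, cocycle1 ZG (alpha tau) a /\ cohomologous_twisted u a b0 b.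
Proof.
move=> mu cb0 [_ [a ca <-]] <-; rewrite H1_act_class // => -[cb [g _ bE]].
by split=> //; exists a; split=> //; exists g.
Qed.

(** An inclusion of orbits suffices, since [a^-1] moves [b'] back to [b]. *)
Lemma H1_orbit_eq u a b b' : modifying_family tau u ->
  cocycle1 [set: gauge P] (alpha_mod tau u) b ->
  cocycle1 [set: gauge P] (alpha_mod tau u) b' ->
  cocycle1 ZG (alpha tau) a -> cohomologous_twisted u a b b' ->
  H1_orbit tau u (class1 [set: gauge P] (alpha_mod tau u) b) =
  H1_orbit tau u (class1 [set: gauge P] (alpha_mod tau u) b').
Proof.
move=> mu; have TG := setT_subgroup (gauge P).
move: a b b'; suff sub (a b b' : S -> gauge P) :
    cocycle1 [set: gauge P] (alpha_mod tau u) b ->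
    cocycle1 [set: gauge P] (alpha_mod tau u) b' ->
    cocycle1 ZG (alpha tau) a -> cohomologous_twisted u a b b' ->
    H1_orbit tau u (class1 [set: gauge P] (alpha_mod tau u) b') `<=`
    H1_orbit tau u (class1 [set: gauge P] (alpha_mod tau u) b).
  move=> a b b' cb cb' ca [g b'E]; apply/seteqP; split; last first.
    by apply: (sub a b b') => //; exists g.
  apply: (sub (fun s => (a s)^-1) b' b) => //; first exact: central_cocycleV.
  have [Za _ _] := ca; exists g^-1 => s.
  rewrite b'E (group_homV (alpha_mod_hom u)) invgK.
  have ZV : ZG (a s)^-1.
    by have [_ _ ZV] := central_subgroup (P := P); exact: ZV.
  rewrite (mulgA (a s)^-1) !(mulgA _ g) (central_gauge_comm _ g ZV).
  by rewrite -!mulgA mulVg mulg1 !mulKg.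
move=> cb cb' ca [g b'E] _ [_ [d cd <-] <-].
exists (class1 ZG (alpha tau) (fun s => d s * a s)).
  by exists (fun s => d s * a s) => //; exact: central_cocycleM.
rewrite !H1_act_class //; last exact: central_cocycleM.
apply: (class1_eq TG (alpha_mod_hom u)); split.
  exact: cocycle1_central_mul.
exists g => // s; have [Zd _ _] := cd.
by rewrite b'E !mulgA (central_gauge_comm _ g (Zd s)).
Qed.

End ModifiedActions.

(** * Connections fixed by a modified action *)

Section ModuliOfConnections.
Context {R : realType} {k n m : nat} {K : lieGroupType R k}.
Context {X : manifoldType R n} {P : principalBundle K X m}.
Context {S : groupType} {rho : S -> X -> X} {th : S -> K -> K}.
Context {tau : equivariantStructure P rho th}.
Variable p0 : P.
Local Open Scope group_scope.
Implicit Types (u v z b : S -> gauge P) (g h : gauge P).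
Implicit Types A : Defs.distribution P.

Local Notation ZK := (@group_center K).
Local Notation ZG := (central_gauge P).
Local Notation gc := (gauge_of_center P).

Lemma beta_gauge_act s g A :
  beta tau s (gauge_act g A) = gauge_act (alpha tau s g) (beta tau s A).
Proof.
rewrite /beta /gauge_act !push_distribution_comp; first last.
- exact: tau_smooth.
- exact: gfun_smooth.
by congr push_distribution; apply/funext => p /=; rewrite tauK.
Qed.

Lemma beta_comp s t A : beta tau s (beta tau t A) = beta tau (s * t) A.
Proof.
rewrite /beta push_distribution_comp; last exact: tau_smooth.
by congr push_distribution; apply/funext => p /=; rewrite tauM.
Qed.

Lemma tangential_beta s A : tangential A -> tangential (beta tau s A).
Proof. by apply: tangential_push; exact: tau_smooth. Qed.

Lemma beta_mod_gauge_act u s g A :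
  beta_mod tau u s (gauge_act g A) =
  gauge_act (alpha_mod tau u s g) (beta_mod tau u s A).
Proof.
by rewrite /beta_mod /alpha_mod beta_gauge_act -!gauge_actM mulgVK.
Qed.

Variable F : set (Defs.distribution P).
Hypothesis F_tangential : forall A, F A -> tangential A.
Hypothesis F_gauge : forall g A, F A -> F (gauge_act g A).
Hypothesis F_stab : forall A, F A -> [set g | gauge_act g A = A] = ZG.

Lemma F_stabP A g : F A -> (gauge_act g A = A <-> ZG g).
Proof. by move=> FA; rewrite -(F_stab A FA). Qed.

Lemma gauge_orbit_refl A : F A -> gauge_orbit A A.
Proof. by move=> FA; exists 1 => //; exact/gauge_act1/F_tangential. Qed.

Lemma gauge_orbit_act g A : F A -> gauge_orbit (gauge_act g A) = gauge_orbit A.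
Proof.
move=> FA; apply/seteqP; split=> _ [h _ <-].
  by exists (h * g) => //; rewrite gauge_actM.
exists (h * g^-1) => //; rewrite gauge_actM gauge_actK //; exact: F_tangential.
Qed.

Lemma beta_fixed v A s : F A -> beta_mod tau v s A = A ->
  beta tau s A = gauge_act (v s)^-1 A.
Proof.
move=> FA vA; rewrite -{2}vA gauge_actK //.
by apply: tangential_beta; exact: F_tangential.
Qed.

(** [c_u(s, t)] fixes [A], hence is central by irreducibility. *)
Lemma fixed_modifying u A : F A -> u 1 = 1 ->
  (forall s, beta_mod tau u s A = A) -> modifying_family tau u.
Proof.
move=> FA u1 uA; split=> // s t; apply/(F_stabP A _ FA).
rewrite /gauge_cochain gauge_actM -(beta_fixed u) // -beta_comp gauge_actM.
rewrite -beta_gauge_act -[gauge_act (u t) _]/(beta_mod tau u t A) uA.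
exact: uA.
Qed.

(** Solving for [z_s] leaves centrality to prove: [z_s] fixes [A] because
[v_s^-1 . A = beta_s A]. *)
Lemma fixed_torsor u v g A : F A ->
  (forall s, beta_mod tau v s A = A) ->
  (forall s, beta_mod tau u s (gauge_act g A) = gauge_act g A) ->
  exists z, [/\ forall s, ZG (z s), (u 1 = 1 -> v 1 = 1 -> z 1 = 1) &
    forall s, u s = g * z s * v s * (alpha tau s g)^-1].
Proof.
move=> FA vA ugA; exists (fun s => g^-1 * u s * alpha tau s g * (v s)^-1).
split=> [s|u1 v1|s]; last by group_simpl.
  apply/(F_stabP A _ FA); rewrite gauge_actM -(beta_fixed v) // gauge_actM.
  rewrite -beta_gauge_act gauge_actM -[gauge_act (u s) _]/(beta_mod tau u s _).
  by rewrite ugA gauge_actK //; exact: F_tangential.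
by rewrite u1 v1 alpha_id; group_simpl.
Qed.

Lemma fixed_conj u v z g A : F A ->
  (forall s, ZG (z s)) -> (forall s, beta_mod tau v s A = A) ->
  (forall s, u s = g * z s * v s * (alpha tau s g)^-1) ->
  forall s, beta_mod tau u s (gauge_act g A) = gauge_act g A.
Proof.
move=> FA Zz vA uE s; rewrite /beta_mod beta_gauge_act -gauge_actM uE mulgVK.
rewrite !gauge_actM -[gauge_act (v s) _]/(beta_mod tau v s A) vA.
by congr gauge_act; apply/F_stabP.
Qed.

Lemma moduli_fixed_orbit v A : F A -> (forall s, beta_mod tau v s A = A) ->
  moduli_fixed tau F (gauge_orbit A).
Proof.
move=> FA vA; exists A => //; split=> // s; apply/seteqP; split.
  move=> _ [_ [g _ <-] <-]; rewrite beta_gauge_act (beta_fixed v) //.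
  by rewrite -gauge_actM; exists (alpha tau s g * (v s)^-1).
move=> _ [g _ <-].
(* solve [alpha_s(h) v_s^-1 = g] for [h] *)
exists (gauge_act (alpha tau s^-1 (g * v s)) A); first by eexists.
rewrite beta_gauge_act -alpha_comp mulgV alpha_id (beta_fixed v) //.
by rewrite -gauge_actM mulgK.
Qed.

(** By [fixed_torsor] all choices of a connection in the orbit and of a family
fixing it lead to cohomologous cochains. *)
Lemma type_map_fixed v A : F A -> v 1 = 1 ->
  (forall s, beta_mod tau v s A = A) ->
  type_map tau (gauge_orbit A) = class2 ZK th (associated_cocycle tau v).
Proof.
move=> FA v1 vA; have mv := fixed_modifying v A FA v1 vA.
apply/seteqP; split=> [c [A' [w [[g _ <-] w1 wA cw]]]|c cv]; last first.
  by exists A, v; split=> //; exact: gauge_orbit_refl.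
have mw := fixed_modifying w _ (F_gauge g A FA) w1 wA.
have [z [Zz z1 wE]] := fixed_torsor w v g A FA vA wA.
rewrite (class2_associated p0 w v z mw mv Zz (z1 w1 v1)) //.
exact: (gauge_cochain_conj p0 w v z g mv Zz wE).
Qed.

Lemma j_map_fixed_orbit v A : F A ->
  j_map [set gauge_act g A | g in gauge_fixed tau v] = gauge_orbit A.
Proof.
move=> FA; apply/seteqP; split=> B.
  by move=> [_ [g _ <-]]; rewrite gauge_orbit_act.
move=> AB; exists A => //; exists 1; last exact/gauge_act1/F_tangential.
by move=> s; exact: group_hom1 (alpha_mod_hom v) s.
Qed.

Lemma im_jP v O : im_j tau F v O <->
  exists A, [/\ F A, forall s, beta_mod tau v s A = A & O = gauge_orbit A].
Proof.
split=> [[_ [A [FA vA ->]] <-]|[A [FA vA ->]]].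
  by exists A; split=> //; exact: j_map_fixed_orbit.
exists [set gauge_act g A | g in gauge_fixed tau v].
  by exists A.
exact: j_map_fixed_orbit.
Qed.

Variable u : S -> gauge P.
Hypothesis u_modifying : modifying_family tau u.

Local Notation H1class := (class1 [set: gauge P] (alpha_mod tau u)).

(** * The decomposition of the type fibre *)

Section Decomposition.
Variable b : set (set (S -> gauge P)) -> S -> gauge P.
Hypothesis b_repr :
  forall o, H1_orbits tau u o -> exists2 B, o B & B (b o).

Lemma repr_cocycle o : H1_orbits tau u o ->
  cocycle1 [set: gauge P] (alpha_mod tau u) (b o) /\
  o = H1_orbit tau u (H1class (b o)).
Proof.
move=> Ho; have [B oB Bb] := b_repr o Ho; case: Ho => B0 [b0 cb0 <-] oE.
rewrite -oE in oB.
have [cb [a [ca abE]]] := H1_orbit_mem p0 u b0 B (b o) u_modifying cb0 oB Bb.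
split=> //; rewrite -{1}oE.
exact: (H1_orbit_eq p0 u a b0 (b o) u_modifying cb0 cb ca abE).
Qed.

(** Since [c_u] belongs to the type, it is cohomologous to [c_w] for some [w]
that fixes a connection [A] of the orbit.  A central correction turns [w] into [v]
with [c_v = c_u], and does not affect [A]. *)
Lemma type_fibre_subset O : moduli_fixed tau F O ->
  type_map tau O = class2 ZK th (associated_cocycle tau u) ->
  (\bigcup_(o in H1_orbits tau u) im_j tau F (twist (b o) u)) O.
Proof.
move=> [A0 FA0 [-> _]] typeE.
have : type_map tau (gauge_orbit A0) (associated_cocycle tau u).
  rewrite typeE; apply: (class2_refl center_subgroup (th_hom p0 (tau := tau))).
  exact: (associated_cocycle2 p0).
move=> [A [w [[g0 _ gA] w1 wA [_ [zeta [Zzeta zeta1 zetaE]]]]]].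
have FA : F A by rewrite -gA; exact: F_gauge.
have mw := fixed_modifying w A FA w1 wA.
have Zz s : ZG (gc (zeta s)) by exists (zeta s).
pose v s := gc (zeta s) * w s.
have vA s : beta_mod tau v s A = A.
  rewrite /beta_mod /v gauge_actM -[gauge_act (w s) _]/(beta_mod tau w s A).
  by rewrite [beta_mod _ _ _ _]wA; apply/F_stabP.
have v1 : v 1 = 1 by rewrite /v zeta1 gauge_of_center1 w1 mulg1.
have vu s t : gauge_cochain tau v s t = gauge_cochain tau u s t.
  rewrite (gauge_cochain_conj p0 v w (fun s => gc (zeta s)) 1 mw Zz);
    last first.
    by move=> r; rewrite alpha1 invg1 mul1g mulg1.
  have [Zcu <-] := associated_cocycleP u s t u_modifying.
  have [Zcw <-] := associated_cocycleP w s t mw.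
  have [Z1 ZM ZV] := center_subgroup (K := K).
  have thZ := th_center p0 (tau := tau).
  have Zt := thZ s _ (Zzeta t).
  have Zst := ZV _ (Zzeta (s * t)).
  have ZZ := ZM _ _ (Zzeta s) Zt.
  have ZZZ := ZM _ _ ZZ Zst.
  rewrite zetaE !gauge_of_centerM // gauge_of_centerV //.
  by rewrite -(alpha_gauge_of_center p0 (tau := tau)).
(* the cocycle attached to the orbit, before passing to representatives *)
pose b0 s := v s * (u s)^-1.
have b0u : twist b0 u = v by apply/funext => s; rewrite /twist /b0 mulgVK.
have [u1 _] := u_modifying.
have cb0 : cocycle1 [set: gauge P] (alpha_mod tau u) b0.
  apply/cocycle1_twist => //; split; first by rewrite /b0 v1 u1 mulgV.
  by rewrite b0u.
pose o := H1_orbit tau u (H1class b0).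
have Ho : H1_orbits tau u o by exists (H1class b0) => //; exists b0.
exists o => //; have [B oB Bb] := b_repr o Ho.
have [cb [a [ca [g bE]]]] := H1_orbit_mem p0 u b0 B (b o) u_modifying cb0 oB Bb.
have [Za _ _] := ca.
(* [g] carries the cocycle [a b0] to the representative [b o]; it carries [A],
   which is also fixed by [twist (a b0) u], to a connection fixed for [b o] *)
apply/im_jP; exists (gauge_act g A); split; [exact: F_gauge| |]; last first.
  by rewrite gauge_orbit_act // -gA gauge_orbit_act.
apply: (fixed_conj _ v a) => // s.
by rewrite /twist bE /b0 /alpha_mod; group_simpl.
Qed.

Lemma type_fibre_supset O o : H1_orbits tau u o ->
  im_j tau F (twist (b o) u) O ->
  moduli_fixed tau F O /\
  type_map tau O = class2 ZK th (associated_cocycle tau u).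
Proof.
move=> /repr_cocycle[cb _] /im_jP[A [FA vA ->]]; split.
  exact: (moduli_fixed_orbit (twist (b o) u)).
have mv := twist_modifying u (b o) u_modifying cb.
have [v1 _] := mv; rewrite (type_map_fixed _ A FA v1 vA).
have [_ cE] := (cocycle1_twist u (b o) u_modifying).1 cb.
have -> // : associated_cocycle tau (twist (b o) u) = associated_cocycle tau u.
apply/funext => s; apply/funext => t.
by rewrite /associated_cocycle cE.
Qed.

(** The central cochain [z] that relates two families fixing connections of the
same orbit is a cocycle, both families having cochain [c_u]. *)
Lemma im_j_disjoint :
  trivIset (H1_orbits tau u) (fun o => im_j tau F (twist (b o) u)).
Proof.
move=> o1 o2 Ho1 Ho2 [Q []].
move=> /im_jP[A [FA v1A QE]] /im_jP[A' [FA' v2A' QE']].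
have [cb1 ->] := repr_cocycle o1 Ho1; have [cb2 ->] := repr_cocycle o2 Ho2.
have : gauge_orbit A A'.
  by rewrite -QE QE'; exact: gauge_orbit_refl.
move=> [g _ gA]; rewrite -{}gA in v2A'.
have mv1 := twist_modifying u _ u_modifying cb1.
have mv2 := twist_modifying u _ u_modifying cb2.
have [z [Zz z1 zE]] :=
  fixed_torsor (twist (b o2) u) (twist (b o1) u) g A FA v1A v2A'.
apply: (H1_orbit_eq p0 u z) => //; last first.
  exists g => s; apply: (mulIg (u s)).
  by rewrite -[LHS]/(twist (b o2) u s) zE /twist /alpha_mod; group_simpl.
split=> // [|s t]; first by apply: z1; [case: mv2|case: mv1].
have := gauge_cochain_conj p0 _ _ z g mv1 Zz zE s t.
have [_ ->] := (cocycle1_twist u _ u_modifying).1 cb1.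
have [_ ->] := (cocycle1_twist u _ u_modifying).1 cb2.
rewrite -{1}(mul1g (gauge_cochain tau u s t)) => /mulIg e.
by rewrite -[LHS]mul1g e /coboundary mulgVK.
Qed.

End Decomposition.

(** * The fibres of the comparison map *)

Section Fibres.
Context {A0 : Defs.distribution P}.
Hypothesis FA0 : F A0.
Hypothesis uA0 : forall s, beta_mod tau u s A0 = A0.

Local Notation fixed_orbit A := [set gauge_act g A | g in gauge_fixed tau u].

(** [g] exhibits the image of [a] in the gauge group as cohomologous to the
trivial cocycle. *)
Definition trivialises (a : S -> K) g :=
  forall s, gc (a s) = g^-1 * alpha_mod tau u s g.

Lemma trivialises_coboundary a a' g w : cocycle1 ZK th a -> trivialises a g ->
  ZK w -> (forall s, a' s = w * a s * (th s w)^-1) ->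
  trivialises a' (g * (gc w)^-1).
Proof.
have uh := alpha_mod_hom (tau := tau) u.
have [Z1 ZM ZV] := center_subgroup (K := K).
move=> [Za _ _] ag Zw a'E s.
have Zsw := th_center p0 (tau := tau) s _ Zw.
have Zwa : ZK (w * a s) by apply: (ZM).
have ZGw : ZG (gc w) by exists w.
rewrite a'E !gauge_of_centerM ?gauge_of_centerV //; last exact: ZV.
rewrite -(alpha_gauge_of_center p0 (tau := tau)) // ag uh (group_homV uh).
rewrite (alpha_mod_central p0 u s (gc w)) //.
by rewrite (invgM g) invgK !mulgA.
Qed.

Lemma orbit_trivialised g :
  (forall s, beta_mod tau u s (gauge_act g A0) = gauge_act g A0) ->
  exists a, cocycle1 ZK th a /\ trivialises a g.
Proof.
have uh := alpha_mod_hom (tau := tau) u.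
move=> ugA.
have Zg s : ZG (g^-1 * alpha_mod tau u s g).
  apply/(F_stabP A0 _ FA0); rewrite gauge_actM.
  rewrite -{1}(uA0 s) -beta_mod_gauge_act ugA gauge_actK //.
  exact: F_tangential.
have g1 : g^-1 * alpha_mod tau u 1 g = 1 by rewrite alpha_mod1 // mulVg.
have [a [Za a1 aE]] := central_lift p0 _ Zg g1.
exists a; split=> //; split=> // s t; apply: (gauge_of_center_inj p0) => //.
  have [_ ZM _] := center_subgroup (K := K).
  by apply: ZM => //; apply: (th_center p0 (tau := tau)).
rewrite gauge_of_centerM //; last exact: (th_center p0 (tau := tau)).
rewrite -(alpha_gauge_of_center p0 (tau := tau)) //.
rewrite -(alpha_mod_central p0 u) ?aE // uh (group_homV uh) alpha_mod_comp //.
by group_simpl.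
Qed.

Lemma H1_kernelP kappa : H1_kernel tau u kappa ->
  exists a g, [/\ cocycle1 ZK th a, kappa = class1 ZK th a & trivialises a g].
Proof.
have TG := setT_subgroup (gauge P).
have thh := th_hom p0 (tau := tau).
move=> [[a0 ca0 <-]] kE.
have c1 : cocycle1 [set: gauge P] (alpha_mod tau u) (fun=> 1).
  by split=> // s t; rewrite (group_hom1 (alpha_mod_hom u)) mulg1.
have : H1class (fun=> 1) (fun=> 1).
  by apply: class1_refl => //; exact: alpha_mod_hom.
rewrite -kE => -[a aa0 [_ [g _ gE]]]; exists a, g; split.
- by case: aa0.
- exact: (class1_eq center_subgroup thh).
- move=> s; apply: (mulgI g); rewrite mulVKg.
  by apply: (mulIg (alpha_mod tau u s g)^-1); rewrite -gE mulgV.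
Qed.

(** A representative of the class of [a] is again of the form [g^-1 alpha_u(g)],
by [trivialises_coboundary]; so its image is the trivial class. *)
Lemma trivialised_kernel a g : cocycle1 ZK th a -> trivialises a g ->
  H1_kernel tau u (class1 ZK th a).
Proof.
have TG := setT_subgroup (gauge P).
have uh := alpha_mod_hom (tau := tau) u.
have thh := th_hom p0 (tau := tau).
have [Z1 ZM ZV] := center_subgroup (K := K).
have triv1 a' g' : trivialises a' g' ->
    H1class (fun=> 1) (fun s => gc (a' s)).
  move=> ag; split; last first.
    by exists g'^-1 => // s; rewrite ag (group_homV uh) invgK mulg1.
  split=> // [|s t]; first by rewrite ag alpha_mod1 // mulVg.
  by rewrite !ag uh (group_homV uh) alpha_mod_comp //; group_simpl.
move=> ca ag; split; first by exists a.
have gE := class1_eq TG uh (triv1 a g ag).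
apply/seteqP; split=> c; last first.
  by rewrite gE => ?; exists a => //; exact: (class1_refl center_subgroup thh).
move=> [a' [_ [w Zw a'E]] a'c].
have ag' := trivialises_coboundary a a' g w ca ag Zw a'E.
by rewrite (class1_eq TG uh (triv1 a' _ ag')).
Qed.

Lemma trivialised_orbit_fixed a g : cocycle1 ZK th a -> trivialises a g ->
  forall s, beta_mod tau u s (gauge_act g A0) = gauge_act g A0.
Proof.
move=> [Za _ _] ag s; rewrite beta_mod_gauge_act uA0.
have -> : alpha_mod tau u s g = g * gc (a s) by rewrite ag mulVKg.
by rewrite gauge_actM; congr gauge_act; apply/F_stabP => //; exists (a s).
Qed.

Lemma fixed_orbit_act g h : gauge_fixed tau u h -> 
  fixed_orbit (gauge_act (h * g) A0) = fixed_orbit (gauge_act g A0).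
Proof.
have uh := alpha_mod_hom (tau := tau) u.
move=> uhh; apply/seteqP; split=> _ [l ul <-].
  exists (l * h); first by move=> s; rewrite uh ul uhh.
  by rewrite -!gauge_actM mulgA.
exists (l * h^-1); first by move=> s; rewrite uh (group_homV uh) ul uhh.
by rewrite -!gauge_actM; group_simpl.
Qed.

(** If [a'] is the coboundary change of [a] by [w], the element [g' w g^-1] is
fixed by the modified action, and it maps [g . A0] to [g' . A0] because [w] acts
trivially. *)
Lemma fixed_orbit_wd a a' g g' : cocycle1 ZK th a ->
  class1 ZK th a a' -> trivialises a g -> trivialises a' g' ->
  fixed_orbit (gauge_act g A0) = fixed_orbit (gauge_act g' A0).
Proof.
have uh := alpha_mod_hom (tau := tau) u.
move=> ca [ca' [w Zw a'E]] ag ag'.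
have ZGw : ZG (gc w) by exists w.
have [_ _ ZGV] := central_subgroup (P := P).
have ag'' := trivialises_coboundary a a' g w ca ag Zw a'E.
pose h := g' * (g * (gc w)^-1)^-1.
have uhh : gauge_fixed tau u h.
  move=> s; rewrite uh (group_homV uh).
  have -> : alpha_mod tau u s g' = g' * gc (a' s) by rewrite ag' mulVKg.
  by rewrite ag'' /h; group_simpl.
rewrite -(fixed_orbit_act _ _ uhh); congr (_ @` _).
have -> : h * g = g' * gc w by rewrite /h; group_simpl.
by rewrite gauge_actM (F_stabP A0 _ FA0).2.
Qed.

(** If [g' . A0 = h g . A0] with [h] fixed, then [g' = h g w] with [w] central,
by irreducibility; [a] and [a'] differ by the coboundary of [w]. *)
Lemma fixed_orbit_inj a a' g g' : cocycle1 ZK th a -> cocycle1 ZK th a' ->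
  trivialises a g -> trivialises a' g' ->
  fixed_orbit (gauge_act g A0) = fixed_orbit (gauge_act g' A0) ->
  class1 ZK th a a'.
Proof.
have uh := alpha_mod_hom (tau := tau) u.
move=> ca ca' ag ag' orbE; split=> //.
have : fixed_orbit (gauge_act g A0) (gauge_act g' A0).
  rewrite orbE; exists 1; last by rewrite -gauge_actM mul1g.
  by move=> s; exact: group_hom1.
move=> [h uhh hg].
have : ZG (g^-1 * h^-1 * g').
  apply/(F_stabP A0 _ FA0); rewrite gauge_actM -hg -!gauge_actM.
  group_simpl; exact/gauge_act1/F_tangential.
move=> [w Zw wE]; exists w^-1.
  by have [_ _ ZV] := center_subgroup (K := K); exact: ZV.
move=> s; have g'E : g' = h * g * gc w by rewrite wE; group_simpl.
rewrite (group_homV (th_hom p0 (tau := tau))) invgK.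
have Zsw := th_center p0 (tau := tau) s _ Zw.
have [Za _ _] := ca.
apply: (gauge_of_center_inj p0); first by case: ca'.
  have [_ ZM ZV] := center_subgroup (K := K).
  by apply: (ZM) => //; apply: (ZM) => //; apply: ZV.
have [_ ZM ZV] := center_subgroup (K := K).
rewrite !gauge_of_centerM ?gauge_of_centerV //; [|exact: ZV|].
  rewrite -(alpha_gauge_of_center p0 (tau := tau)) //.
  rewrite -(alpha_mod_central p0 u s (gc w)); last by exists w.
  by rewrite ag' ag g'E !uh uhh; group_simpl.
by apply: (ZM) => //; apply: ZV.
Qed.

(** Sends the class of [a = g^-1 alpha_u(g)] to the orbit of [g . A0] under the
fixed subgroup. *)
Lemma fibre_card :
  (fixed_moduli tau F u `&` j_map (P := P) @^-1` [set gauge_orbit A0]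
     #= H1_kernel tau u)%card.
Proof.
have kerP (kappa : set (S -> K)) : exists ag : (S -> K) * gauge P,
    H1_kernel tau u kappa -> [/\ cocycle1 ZK th ag.1,
      kappa = class1 ZK th ag.1 & trivialises ag.1 ag.2].
  have [/H1_kernelP[a [g ?]]|nk] := pselect (H1_kernel tau u kappa).
    by exists (a, g).
  by exists (fun=> 1, 1) => /nk.
have [ag agP] := choice kerP.
pose Phi kappa := fixed_orbit (gauge_act (ag kappa).2 A0).
have -> : fixed_moduli tau F u `&` j_map (P := P) @^-1` [set gauge_orbit A0] =
    Phi @` H1_kernel tau u.
  apply/seteqP; split.
    move=> _ [[A [FA uA ->]] /=]; rewrite j_map_fixed_orbit // => OE.
    have : gauge_orbit A0 A by rewrite -OE; exact: gauge_orbit_refl.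
    move=> [g _ gA]; rewrite -{}gA in FA uA OE *.
    have [a [ca aE]] := orbit_trivialised g uA.
    have Hk := trivialised_kernel a g ca aE.
    exists (class1 ZK th a) => //; have [ca' cE ag'] := agP _ Hk.
    apply: (fixed_orbit_wd (ag (class1 ZK th a)).1 a) => //.
    rewrite -cE; apply: class1_refl => //; first exact: center_subgroup.
    exact: (th_hom p0 (tau := tau)).
  move=> _ [kappa Hk <-]; have [ca' cE ag'] := agP _ Hk.
  split; last first.
    by rewrite /Phi /= j_map_fixed_orbit ?gauge_orbit_act //; exact: F_gauge.
  exists (gauge_act (ag kappa).2 A0); split=> //; first exact: F_gauge.
  exact: (trivialised_orbit_fixed (ag kappa).1).
apply: inj_card_eq => kappa kappa'; rewrite !inE => Hk Hk' PhiE.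
have [ca cE ag1] := agP _ Hk; have [ca' cE' ag1'] := agP _ Hk'.
rewrite cE cE'; apply: (class1_eq center_subgroup (th_hom p0 (tau := tau))).
exact: (fixed_orbit_inj _ _ _ _ ca ca' ag1 ag1').
Qed.

End Fibres.

End ModuliOfConnections.

(** * Irreducible connections of prescribed curvature *)

Section IrreducibleFibre.
Context {R : realType} {k n m : nat} {K : lieGroupType R k}.
Context {X : manifoldType R n} {P : principalBundle K X m}.

(** The stabiliser of [g . H] is the conjugate by [g] of that of [H], and the
central gauge transformations are invariant under conjugation. *)
Lemma irreducible_push (g : gauge P) (H : Defs.distribution P) :
  tangential H -> irreducible H -> irreducible (gauge_act g H).
Proof.
move=> tH irrH.
have tgH : tangential (gauge_act g H).
  by apply: tangential_push => //; exact: gfun_smooth.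
have stabP h : gauge_act h H = H <-> central_gauge P h by rewrite -irrH.
apply/seteqP; split=> h /=.
  move=> ghg; have Zc : central_gauge P (g^-1 * h * g)%g.
    by apply/stabP; rewrite !gauge_actM ghg gauge_actK.
  suff -> : h = (g^-1 * h * g)%g by [].
  rewrite -(central_gauge_conj _ g Zc).
  by rewrite !mulgA mulgK mulgV mul1g.
move=> Zh; rewrite -gauge_actM (central_gauge_comm _ g Zh) gauge_actM.
by congr gauge_act; apply/stabP.
Qed.

Lemma irreducible_fibre_push (om : X -> tvec X -> tvec X -> R) (xi : tvec K)
    (g : gauge P) (H : Defs.distribution P) :
  irreducible_fibre P om xi H -> irreducible_fibre P om xi (gauge_act g H).
Proof.
move=> [[cH kH] irrH]; have tH : tangential H by case: cH.
split; last exact: irreducible_push.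
by split; [exact: connection_push|exact: curvature_push].
Qed.

Lemma bundle_inhabited (x : X) : exists p : P, pproj p = x.
Proof.
have [U [kappa [psi [[_ Ux _ _] [_ _ psiE]]]]] := ptriv P x.
by exists (psi (x, 1%g)); have [] := psiE x 1%g Ux.
Qed.

End IrreducibleFibre.

(** On the empty manifold every family of coefficients represents the zero form,
which contradicts uniqueness in dimension at least one. *)
Lemma betti_inhabited (R : realType) (n : nat) (M : manifoldType R n)
    (b : nat) :
  first_betti_number M b.+1 -> exists x : M, True.
Proof.
move=> [alpha [_ alphaP]]; have [//|noM] := pselect (exists x : M, True).
have no (x : M) : False by apply: noM; exists x.
have [||c [_ uniq_c]] := alphaP (fun _ _ => 0).
- by split=> [p|V _]; [case: (no p)|exact: smooth_cst].
- by move=> V W _ _ p; case: (no p).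
have every (c' : 'rV[R]_b.+1) : c = c'.
  apply: uniq_c; exists (fun=> 0); first exact: smooth_cst.
  by move=> p; case: (no p).
have /rowP/(_ ord0) : 0 = const_mx 1 :> 'rV[R]_b.+1.
  by rewrite -(every 0) (every (const_mx 1)).
by rewrite !mxE => /eqP; rewrite eq_sym oner_eq0.
Qed.

Theorem theorem2p11 (R : realType)
    (X : complexManifoldType R 1) (X_compact : compact [set: X])
    (X_connected : connected [set: X])
    (g : nat) (X_genus : genus X g) (g_ge2 : (2 <= g)%N)
    (Sigma : groupType) (rho : Sigma -> X -> X) (rho_aut : aut_subgroup rho)
    (d : nat) (G : complexLieGroupType R d) (G_connected : connected [set: G])
    (G_reductive : reductive G)
    (theta : G -> G) (theta_split : split_involution theta)
    (k : nat) (K : lieGroupType R k) (iota : K -> G)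
    (K_max : maximal_compact iota)
    (thetaK : K -> K) (thetaK_iota : forall x, iota (thetaK x) = theta (iota x))
    (m : nat) (P : principalBundle K X m)
    (metric : X -> tvec X -> tvec X -> R)
    (metric_riemannian : riemannian_metric metric)
    (metric_compatible : compatible_metric metric)
    (metric_invariant : forall s, metric_isometry metric (rho s))
    (xi : tvec K) (xi_central : lie_algebra_center xi)
    (fibre_neq0 : curvature_fibre P (area_form metric) xi !=set0)
    (tau : equivariantStructure P rho (theta_action rho thetaK))
    (u : Sigma -> gauge P) (u_modifying : modifying_family tau u) :
  let F := irreducible_fibre P (area_form metric) xi in
  (* any choice of a representative cocycle in each orbit *)
  (forall b : set (set (Sigma -> gauge P)) -> Sigma -> gauge P,
     (forall o, H1_orbits tau u o -> exists2 B, o B & B (b o)) ->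
     [set O | moduli_fixed tau F O /\
              type_map tau O = class2 (@group_center K) (theta_action rho thetaK)
                                 (associated_cocycle tau u)]
       = \bigcup_(o in H1_orbits tau u) im_j tau F (twist (b o) u)
     /\ trivIset (H1_orbits tau u) (fun o => im_j tau F (twist (b o) u)))
  /\
  (forall O, im_j tau F u O ->
     (fixed_moduli tau F u `&` j_map (P := P) @^-1` [set O]
        #= H1_kernel tau u)%card).
Proof.
move=> F.
have [x _] : exists x : X, True.
  by case: g g_ge2 X_genus => // g' _; exact: betti_inhabited.
have [p0 _] := bundle_inhabited (P := P) x.
have F_tan A : F A -> tangential A by move=> [[[]]].
have F_act (h : gauge P) A : F A -> F (gauge_act h A).
  exact: irreducible_fibre_push.
have F_stab A : F A -> [set h | gauge_act h A = A] = central_gauge P.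
  by move=> [].
split=> [b b_repr|Q QF].
  split; last exact: (im_j_disjoint p0).
  apply/seteqP; split=> [Q [Qfix Qtype]|Q [c Hc Qc]].
    exact: (type_fibre_subset p0).
  exact: (type_fibre_supset p0 F F_tan F_act F_stab u u_modifying b b_repr Q c).
have [A [FA uA ->]] := (im_jP F F_tan u Q).1 QF.
exact: (fibre_card p0).
Qed.
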